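(* Let $m\in\{2,3,4,5\}$, let $a,b,c\in\mathbb{Z}$ be such that $f(x)=x^6+ax^m+bx+c$ is irreducible over $\mathbb{Q}$, and let $K=\mathbb{Q}(\theta)$ where $\theta$ is a root of $f(x)$. (i) If $a$, $b$ and $c+1$ are all divisible by $8$, then $v_2(i(K))=2$. (ii) If $a$, $b$ and $c+1$ are all divisible by $9$, then $v_3(i(K))=1$. In either case, $K$ is non-monogenic.
   Context: $O_K$ denotes the ring of algebraic integers of $K$. For $\alpha\in O_K$, $\operatorname{ind}\alpha$ denotes the index of the subgroup $\mathbb{Z}[\alpha]$ in $O_K$ (as additive groups). The index of the field is $i(K)=\gcd\{\operatorname{ind}\alpha : \alpha\in O_K,\ K=\mathbb{Q}(\alpha)\}$. For a rational prime $p$ and an integer $r$, $v_p(r)$ is the exponent of the highest power of $p$ dividing $r$. $K$ is called monogenic if $O_K=\mathbb{Z}[\alpha]$ for some $\alpha\in O_K$, and non-monogenic otherwise. *)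

(* Defs.v *)
From HB Require Import structures.
From mathcomp Require Import all_boot all_order all_algebra all_field.
From mathcomp Require Import finmap.
From mathcomp Require Import all_classical.

Set Implicit Arguments.
Unset Strict Implicit.
Unset Printing Implicit Defensive.

Import Order.TTheory GRing.Theory Num.Theory.
Local Open Scope classical_set_scope.
Local Open Scope ring_scope.

Definition sextic (m : nat) (a b c : int) : {poly int} :=
  'X^6 + a *: 'X^m + b *: 'X + c%:P.

(* Number fields are finite extensions of rat. *)
Section NumberField.
Variable K : fieldExtType rat.

Definition int_ring : set K :=
  [set x | integralOver (intr : int -> K) x].

Definition Zadjoin (alpha : K) : set K :=
  [set (map_poly intr p).[alpha] | p in [set: {poly int}]].

Definition generates (alpha : K) : Prop := <<1; alpha>>%VS = {:K}%VS.

Definition add_coset (B : set K) (x : K) : set K := [set x + z | z in B].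

(* fset_set sends an infinite set to the empty one, so the index is 0 when
   there are infinitely many cosets. *)
Definition add_index (A B : set K) : nat := #|` fset_set [set add_coset B x | x in A]|.

Definition ind (alpha : K) : nat := add_index int_ring (Zadjoin alpha).

Definition monogenic : Prop :=
  exists2 alpha : K, int_ring alpha & int_ring = Zadjoin alpha.

End NumberField.

(* The gcd of a possibly infinite set of naturals, characterized by its
   divisors; it is 0 when the set has no positive element. *)
Definition set_gcd (S : set nat) : nat :=
  xget 0%N [set d : nat | forall e : nat,
    (e %| d)%N <-> forall n, S n -> (e %| n)%N].

Lemma set_gcdP (S : set nat) (e : nat) :
  (e %| set_gcd S)%N <-> forall n, S n -> (e %| n)%N.
Proof.
suff [d dP] : exists d, forall e : nat,
    (e %| d)%N <-> forall n, S n -> (e %| n)%N.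
  rewrite /set_gcd; case: xgetP => [d' _ /(_ e)//|/(_ d)[]]; exact: dP.
pose G d := forall e : nat, (forall n, S n -> (e %| n)%N) -> (e %| d)%N.
have [[n0 Sn0 n0_gt0]|S0] := pselect (exists2 n, S n & (0 < n)%N); last first.
  exists 0%N => e'; rewrite dvdn0; split=> // _ n Sn.
  case: n Sn => // n Sn; by case: S0; exists n.+1.
have exG : exists d, `[< (0 < d)%N /\ G d >].
  by exists n0; apply/asboolP; split=> // e' /(_ _ Sn0).
case: (ex_minnP exG) => d /asboolP[d_gt0 Gd] dmin.
exists d => e'; split=> [e'd n Sn|/Gd//].
apply: (dvdn_trans e'd).
have : (d <= gcdn d n)%N.
  apply: dmin; apply/asboolP; split; first by rewrite gcdn_gt0 d_gt0.
  by move=> f fS; rewrite dvdn_gcd (Gd _ fS) fS.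
move=> le_d; have /eqP <- : gcdn d n == d.
  by rewrite eqn_leq le_d andbT dvdn_leq ?dvdn_gcdl.
exact: dvdn_gcdr.
Qed.

Definition field_index (K : fieldExtType rat) : nat :=
  set_gcd [set ind alpha | alpha in [set x : K | int_ring x /\ generates x]].

(* Main.v *)
(* The primes 2 and 3 obstruct monogenicity because [K] has too many primes of
   small residue degree above them.  Put [S = Z[theta, eps]] with
   [eps = (theta^3 + 1) / 2] at 2 and [S = Z[theta, e]] with
   [e = (theta^4 + theta^2 + 1) / 3] at 3: these idempotents of
   [Q[x] / (x^6 - 1)] become integral in [K] since [f = x^6 - 1] modulo 8 or 9,
   and [S] turns out to have index prime to [p] in the ring of integers [O].
   The ring [O / 2] is [F_2^2 x F_4^2], so [x^4 = x] in it, and every element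
   of [O / 3], which is [F_3^2 x (F_3[t] / t^2)^2], is killed by a monic
   polynomial of degree 5.  Hence [Z[alpha]] spans at most 4, respectively 5,
   of the 6 dimensions of [O / p], so [4 | ind alpha], respectively
   [3 | ind alpha], for every generator [alpha].  For a suitable [alpha],
   adjoining to its first powers the quotients by [p] of these polynomial
   relations gives a basis of [O] at [p], so the bounds are attained.  The
   index of [Z[alpha]] is finite because the trace form is nondegenerate and
   integral on [O]. *)

Require Import Defs.
From HB Require Import structures.
From mathcomp Require Import all_boot all_order all_algebra all_field.
From mathcomp Require Import all_fingroup all_solvable.
From mathcomp Require Import finmap all_classical.
From mathcomp Require Import ring zify.

Set Implicit Arguments.
Unset Strict Implicit.
Unset Printing Implicit Defensive.

Import Order.TTheory GRing.Theory Num.Theory.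
Local Open Scope classical_set_scope.
Local Open Scope ring_scope.

(** * Indices of additive subgroups *)

Section Index.
Variable K : fieldExtType rat.

(** Over [F_2] there is a single irreducible quadratic, so the two primes with residue field [F_4]
    give the same factor in the minimal polynomial of an element of [O / 2]; over [F_3], four primes
    have only three residues to share. This is where the dimensions are lost. The quotient [gamma]
    of the polynomial relation by [p] has to tell the colliding primes apart, and its residues
    depend on [f] beyond the given modulus: on [v = (theta^6 - 1) / 8] modulo 2 and on
    [u = (theta^6 - 1) / 9] modulo 3. One [alpha] works for every [v], whereas at 3 the choice
    depends on [u]. Maximality of [S] at [p] means that an integral [z] with [p z] in [S] satisfies
    [p z] in [p S]. Such a [p z] is nilpotent in [S / p]. At 2 that ring is reduced, which is
    enough; at 3 the nilpotent multiples of [theta^2 - 1] need a second argument. [add_index] is 0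
    when there are infinitely many cosets, so every index is computed in a finite group of
    coordinates modulo an integer, where the theorems of Lagrange and Cauchy apply. *)

Definition zmod_set (A : set K) := A 0 /\ forall x y, A x -> A y -> A (x - y).

Lemma zmod_setN (A : set K) x : zmod_set A -> A x -> A (- x).
Proof. by case=> A0 AB Ax; rewrite -sub0r; apply: AB. Qed.

Lemma zmod_setD (A : set K) x y : zmod_set A -> A x -> A y -> A (x + y).
Proof.
by move=> zA Ax Ay; rewrite -[y]opprK; apply: (zA.2) => //; apply: zmod_setN.
Qed.

Lemma zmod_setMn (A : set K) x n : zmod_set A -> A x -> A (x *+ n).
Proof.
move=> zA Ax; elim: n => [|n IHn]; first by rewrite mulr0n; case: zA.
by rewrite mulrS; apply: zmod_setD.
Qed.

Section FiniteImage.
Variables (W : finZmodType) (pi : K -> W).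

Definition im_set (A : set K) : {set W} :=
  [set w | `[< exists2 x, A x & pi x = w >]].

Lemma im_setP (A : set K) w :
  reflect (exists2 x, A x & pi x = w) (w \in im_set A).
Proof. by rewrite inE; apply: asboolP. Qed.

Variables (A B : set K).
Hypotheses (zA : zmod_set A) (zB : zmod_set B) (sBA : B `<=` A).
Hypothesis piB : forall x y, A x -> A y -> pi (x - y) = pi x - pi y.
Hypothesis kerB : forall x, A x -> pi x = 0 -> B x.

Lemma im_group_set (C : set K) : zmod_set C -> C `<=` A ->
  group_set (im_set C).
Proof.
move=> zC sCA; have pi0 : pi 0 = 0.
  by have := piB zA.1 zA.1; rewrite !subrr.
apply/group_setP; split.
  by apply/im_setP; exists 0 => //; case: zC.
move=> _ _ /im_setP[x Cx <-] /im_setP[y Cy <-]; apply/im_setP.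
have Cy' := zmod_setN zC Cy.
exists (x - - y); first exact: (zC.2).
have -> : pi (x - - y) = pi x - (pi 0 - pi y).
  rewrite piB; [|exact: sCA|exact: sCA].
  by rewrite -[- y]sub0r piB //; [exact: zA.1|exact: sCA].
by rewrite pi0 sub0r opprK.
Qed.

(** The kernel of [pi] on [A] lies in [B], so two elements of [A] are congruent modulo [B] exactly
    when their images are congruent modulo the image of [B]. *)
Lemma add_indexE : add_index A B = #|im_set A : im_set B|%g.
Proof.
pose GB := Group (im_group_set zB sBA).
pose GA := Group (im_group_set zA (@subset_refl _ A)).
(* [lift] picks a preimage in [A]; outside the image of [A] it takes the default value 0. *)
have /choice[lift liftP] (w : W) : exists x, w \in GA -> A x /\ pi x = w.
  have [/im_setP[x Ax xw]|] := boolP (w \in GA); last by exists 0.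
  by exists x.
pose F (R : {set W}) : set K := add_coset B (lift (repr R)).
have cosetE x y : A x -> A y ->
    add_coset B x = add_coset B y <-> pi x - pi y \in GB.
  move=> Ax Ay; split=> [eqxy|/im_setP[b Bb bE]].
    have : add_coset B y x by rewrite -eqxy; exists 0; [case: zB|rewrite addr0].
    by case=> b Bb e; rewrite -piB // -e addrAC subrr add0r; apply/im_setP; exists b.
  have Bxy : B (x - y).
    have Axy : A (x - y) by apply: zA.2.
    rewrite -[_ - _](subrK b); apply: zmod_setD => //.
    apply: kerB; first by apply: (zA.2) => //; apply: sBA.
    by rewrite piB ?piB ?bE ?subrr //; apply: sBA.
  apply/seteqP; split=> _ [z Bz <-].
    exists ((x - y) + z); first exact: zmod_setD.
    by ring.
  exists (z - (x - y)); first exact: (zB.2).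
  by ring.
have repr_in R : R \in rcosets GB GA -> repr R \in GA.
  case/rcosetsP=> w GAw ->; case: repr_rcosetP => b GBb; apply: groupM => //.
  case/im_setP: GBb => x Bx <-; apply/im_setP; exists x => //; exact: sBA.
have setE : [set add_coset B x | x in A] = F @` [set` rcosets GB GA].
  apply/seteqP; split=> [_ [x Ax <-]|_ [R RA <-]].
    have GAx : pi x \in GA by apply/im_setP; exists x.
    exists (GB :* pi x)%g; first by apply/rcosetsP; exists (pi x).
    have RA : (GB :* pi x)%g \in rcosets GB GA by apply/rcosetsP; exists (pi x).
    have [Al Fl] := liftP _ (repr_in _ RA).
    apply/cosetE => //; rewrite {}Fl; case: repr_rcosetP => b GBb.
    by rewrite FinRing.zmodMgE addrK.
  by exists (lift (repr R)) => //; case: (liftP _ (repr_in _ RA)).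
rewrite /add_index setE fset_set_image //.
rewrite card_in_imfset /=; last first.
  move=> R1 R2; rewrite !in_fset_set // !inE => R1A R2A.
  have [A1 e1] := liftP _ (repr_in _ R1A).
  have [A2 e2] := liftP _ (repr_in _ R2A).
  move/cosetE => /(_ A1 A2); rewrite e1 e2.
  case/rcosetsP: R1A => w1 _ {e1 A1}->; case/rcosetsP: R2A => w2 _ {e2 A2}->.
  case: (repr_rcosetP GB w1) => b1 Gb1; case: (repr_rcosetP GB w2) => b2 Gb2.
  rewrite -!FinRing.zmodVgE -!FinRing.zmodMgE => Hb.
  have: w1 \in (GB :* w2)%g.
    rewrite mem_rcoset; move: Hb; rewrite invMg.
    by rewrite -!mulgA groupMl // mulgA groupMr ?groupV.
  by move/rcoset_eqP.
have -> : #|im_set A : im_set B|%g = #|rcosets GB GA| by [].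
rewrite cardE; apply/perm_size/uniq_perm; rewrite ?fset_uniq ?enum_uniq //.
move=> R; rewrite mem_enum [LHS]in_fset_set //.
by apply/idP/idP => [/set_mem|RA]; last exact/mem_set.
Qed.

End FiniteImage.

(** One [pi] that detects [B] serves all three pairs, so this is Lagrange's theorem for the
    images. *)
Lemma tower (W : finZmodType) (pi : K -> W) (A H B : set K) :
    zmod_set A -> zmod_set H -> zmod_set B -> B `<=` H -> H `<=` A ->
    (forall x y, A x -> A y -> pi (x - y) = pi x - pi y) ->
    (forall x, A x -> pi x = 0 -> B x) ->
  add_index A B = (add_index A H * add_index H B)%N.
Proof.
move=> zA zH zB sBH sHA piB kerB.
have sBA : B `<=` A by move=> x /sBH/sHA.
have piBH x y : H x -> H y -> pi (x - y) = pi x - pi y.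
  by move=> Hx Hy; apply: piB; apply: sHA.
rewrite (add_indexE zA zB sBA piB kerB).
rewrite (add_indexE zA zH sHA piB (fun x Ax e => sBH _ (kerB x Ax e))).
rewrite (add_indexE zH zB sBH piBH (fun x Hx => kerB x (sHA _ Hx))).
pose GA := Group (im_group_set zA piB zA (@subset_refl _ A)).
pose GH := Group (im_group_set zA piB zH sHA).
pose GB := Group (im_group_set zA piB zB sBA).
have im_sub (C D : set K) : C `<=` D -> im_set pi C \subset im_set pi D.
  move=> sCD; apply/fintype.subsetP=> _ /im_setP[x Cx <-].
  by apply/im_setP; exists x => //; apply: sCD.
exact/esym/(@Lagrange_index _ GA GH GB (im_sub _ _ sHA) (im_sub _ _ sBH)).
Qed.

Lemma add_index_id (A : set K) : zmod_set A -> add_index A A = 1%N.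
Proof.
move=> zA; rewrite /add_index.
suff -> : [set add_coset A x | x in A] = [set A] by rewrite fset_set1 cardfs1.
have cosetA x : A x -> add_coset A x = A.
  move=> Ax; apply/seteqP; split=> [_ [z Az <-]|z Az]; first exact: zmod_setD.
  by exists (z - x); [exact: zA.2|rewrite addrC subrK].
apply/seteqP; split=> [_ [x Ax <-]|_ ->]; first exact: cosetA.
by exists 0; [exact: zA.1|apply: cosetA; exact: zA.1].
Qed.

Lemma index_kernel (p r : nat) (phi : K -> 'rV['F_p]_r) (A : set K) :
    prime p -> zmod_set A ->
    (forall x y, A x -> A y -> phi (x - y) = phi x - phi y) ->
    (forall v, exists2 x, A x & phi x = v) ->
  add_index A [set x | A x /\ phi x = 0] = (p ^ r)%N.
Proof.
move=> p_pr zA phiB phi_surj.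
have phi0 : phi 0 = 0 by have := phiB _ _ zA.1 zA.1; rewrite !subrr.
have zH : zmod_set [set x | A x /\ phi x = 0].
  split; first by split; first exact: zA.1.
  move=> x y [Ax x0] [Ay y0]; split; first exact: zA.2.
  by rewrite phiB // x0 y0 subrr.
rewrite (add_indexE (pi := phi) zA zH) //; last by move=> x [].
have -> : im_set phi [set x | A x /\ phi x = 0] = 1%g.
  apply/setP=> v; rewrite inE inE; apply/asboolP/eqP=> [[x [_ x0] <-]|->].
    exact: x0.
  by exists 0 => //; case: zH.
rewrite (@indexg1 _ (Group (im_group_set zA phiB zA (@subset_refl _ A)))) /=.
have -> : #|im_set phi A| = #|{: 'rV['F_p]_r}|.
  by apply: eq_card => v; rewrite [RHS]inE; apply/im_setP.
by rewrite card_mx mul1n card_Fp.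
Qed.

(** If [p] divided the index, Cauchy's theorem would give a class of order [p] in the quotient of
    the images, that is, some [x] in [A] outside [B] with [p x] in [B]. *)
Lemma index_coprime (W : finZmodType) (pi : K -> W) (p : nat) (A B : set K) :
    prime p -> zmod_set A -> zmod_set B -> B `<=` A ->
    (forall x y, A x -> A y -> pi (x - y) = pi x - pi y) ->
    (forall x, A x -> pi x = 0 -> B x) ->
    (forall x, A x -> B (x *+ p) -> B x) ->
  ~~ (p %| add_index A B)%N.
Proof.
move=> p_pr zA zB sBA piB kerB torsion; apply/negP.
rewrite (add_indexE zA zB sBA piB kerB).
pose GA := Group (im_group_set zA piB zA (@subset_refl _ A)).
pose GB := Group (im_group_set zA piB zB sBA).
have nGB : (GA \subset 'N(GB))%g.
  by apply: sub_abelian_norm; [exact: FinRing.zmod_abelian|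
    apply/fintype.subsetP=> _ /im_setP[x Bx <-]; apply/im_setP; exists x; first exact: (sBA _ Bx)].
have -> : #|im_set pi A : im_set pi B|%g = #|GA / GB|%g by rewrite card_quotient.
case/(Cauchy p_pr) => X /morphimP[w Nw /im_setP[x Ax piw] ->] oX.
have pi0 : pi 0 = 0 by have := piB _ _ zA.1 zA.1; rewrite !subrr.
have piD y z : A y -> A z -> pi (y + z) = pi y + pi z.
  move=> Ay Az; have AN := zmod_setN zA Az.
  have -> : y + z = y - (0 - z) by rewrite sub0r opprK.
  rewrite piB //; last by rewrite sub0r.
  by rewrite piB //; [rewrite pi0 sub0r opprK|exact: zA.1].
have piMn n : pi (x *+ n) = pi x *+ n.
  elim: n => [|n IHn]; first by rewrite !mulr0n.
  by rewrite !mulrS piD ?IHn //; apply: zmod_setMn.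
have memB y : A y -> pi y \in GB -> B y.
  move=> Ay /im_setP[b Bb bE]; rewrite -[y](subrK b); apply: zmod_setD => //.
  by apply: kerB; [apply: (zA.2) => //; apply: (sBA _ Bb)|
                   rewrite piB // ?bE ?subrr //; apply: (sBA _ Bb)].
have wp : (w ^+ p)%g \in GB.
  apply/coset_idr; first by rewrite groupX.
  by rewrite morphX // -[p in (_ ^+ p)%g]oX; apply: expg_order.
have : B x.
  apply: torsion => //; apply: memB; first exact: zmod_setMn.
  by rewrite piMn piw -FinRing.zmodXgE.
move=> Bx; have w0 : coset GB w = 1%g.
  by apply: coset_id; rewrite -piw; apply/im_setP; exists x.
have {oX} : #[coset GB w]%g = p by exact: oX.
by rewrite w0 order1 => p1; move: p_pr; rewrite -p1.
Qed.

End Index.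
(** * Integrality and the trace form *)

Section IntegralClosure.
Variable K : fieldExtType rat.
Implicit Types (x y : K) (m : int).

Lemma int_ring_int m : int_ring (m%:~R : K).
Proof. exact: integral_id. Qed.

Lemma int_ringD x y : int_ring x -> int_ring y -> int_ring (x + y).
Proof. exact: integral_add. Qed.

Lemma int_ringN x : int_ring x -> int_ring (- x).
Proof. exact: integral_opp. Qed.

Lemma int_ringB x y : int_ring x -> int_ring y -> int_ring (x - y).
Proof. exact: integral_sub. Qed.

Lemma int_ringM x y : int_ring x -> int_ring y -> int_ring (x * y).
Proof. exact: integral_mul. Qed.

Lemma int_ring0 : int_ring (0 : K).
Proof. exact: (int_ring_int 0). Qed.

Lemma int_ring1 : int_ring (1 : K).
Proof. exact: (int_ring_int 1). Qed.

Lemma int_ringX x n : int_ring x -> int_ring (x ^+ n).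
Proof.
move=> Ox; elim: n => [|n IHn]; first by rewrite expr0; exact: int_ring1.
by rewrite exprS; apply: int_ringM.
Qed.

Lemma zmod_int_ring : zmod_set (@int_ring K).
Proof. by split; [exact: int_ring0 | move=> x y; exact: int_ringB]. Qed.

Lemma int_ring_sum (I : finType) (F : I -> K) :
  (forall i, int_ring (F i)) -> int_ring (\sum_i F i).
Proof.
move=> OF; apply: big_ind => //; [exact: int_ring0 | exact: int_ringD].
Qed.

Lemma int_ring_horner (p : {poly int}) x :
  int_ring x -> int_ring (map_poly intr p).[x].
Proof.
move=> Ox; rewrite horner_poly; apply: int_ring_sum => i.
by apply: int_ringM; [exact: int_ring_int | exact: int_ringX].
Qed.

Lemma zmod_Zadjoin x : zmod_set (Zadjoin x).
Proof.
split; first by exists 0 => //; rewrite rmorph0 horner0.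
move=> _ _ [p _ <-] [q _ <-]; exists (p - q) => //.
by rewrite rmorphB hornerD hornerN.
Qed.

Lemma Zadjoin_sub x : int_ring x -> Zadjoin x `<=` @int_ring K.
Proof. by move=> Ox _ [p _ <-]; exact: int_ring_horner. Qed.

Lemma rat_int_scale (c : int) x : (c%:~R : rat) *: x = c%:~R * x.
Proof. by rewrite scaler_int mulrzl. Qed.

Section TraceForm.
Variables (n : nat) (g : n.-tuple K).
Hypothesis g_basis : basis_of fullv g.

Definition mult_mx x : 'M[rat]_n := \matrix_(i, j) coord g i (x * g`_j).
Definition mult_trace x : rat := \tr (mult_mx x).

Lemma basis_coord x : x = \sum_(i < n) coord g i x *: g`_i.
Proof. by rewrite -(coord_basis g_basis) ?memvf. Qed.

Lemma mult_traceE x : mult_trace x = \sum_(i < n) coord g i (x * g`_i).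
Proof. by rewrite /mult_trace /mxtrace; under eq_bigr do rewrite mxE. Qed.

Lemma mult_trace1 : mult_trace 1 = n%:R.
Proof.
rewrite mult_traceE (eq_bigr (fun=> 1)) ?sumr_const ?card_ord // => i _.
by rewrite mul1r coord_free ?eqxx //; apply: basis_free g_basis.
Qed.

Lemma mult_trace_is_scalar : scalar mult_trace.
Proof.
move=> a x y; rewrite !mult_traceE mulr_sumr -big_split /=.
by apply: eq_bigr => i _; rewrite mulrDl -scalerAl linearP.
Qed.

HB.instance Definition _ :=
  GRing.isLinear.Build rat K rat *%R mult_trace mult_trace_is_scalar.

(* A left eigenvector [w] for [lambda] defines a linear form [s] on [K] with
   [s (x * y) = lambda * s y], so every integer polynomial that annihilates
   [x] also annihilates [lambda]. *)
Lemma mult_mx_eigenvalue x (lambda : algC) :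
  int_ring x -> eigenvalue (map_mx ratr (mult_mx x)) lambda -> lambda \in Aint.
Proof.
case=> p p_monic /eqP px0 /eigenvalueP[w wE w_neq0].
pose s y : algC := \sum_i w 0 i * ratr (coord g i y).
have sD y z : s (y + z) = s y + s z.
  by rewrite -big_split; apply: eq_bigr => i _; rewrite linearD rmorphD mulrDr.
have sZ a y : s (a *: y) = ratr a * s y.
  rewrite mulr_sumr; apply: eq_bigr => i _.
  by rewrite linearZ /= rmorphM mulrCA.
have s0 : s 0 = 0 by rewrite -(scale0r 0) sZ rmorph0 mul0r.
have s_sum (I : finType) (F : I -> K) : s (\sum_i F i) = \sum_i s (F i).
  exact: (big_morph s sD s0).
have sg (i : 'I_n) : s g`_i = w 0 i.
  rewrite /s (bigD1 i) //= coord_free ?(basis_free g_basis) // eqxx rmorph1 mulr1.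
  rewrite big1 ?addr0 // => j ji.
  by rewrite coord_free ?(basis_free g_basis) // eq_sym (negPf ji) rmorph0 mulr0.
have sx y : s (x * y) = lambda * s y.
  rewrite [y]basis_coord mulr_sumr !s_sum mulr_sumr; apply: eq_bigr => i _.
  rewrite -scalerAr !sZ mulrCA; congr (_ * _); rewrite sg.
  have := congr1 (fun v : 'rV_n => v 0 i) wE; rewrite !mxE => <-.
  by apply: eq_bigr => j _; rewrite !mxE.
have sX k y : s (x ^+ k * y) = lambda ^+ k * s y.
  by elim: k => [|k IHk]; rewrite ?expr0 ?mul1r // !exprS -!mulrA sx IHk.
have sp y : s ((map_poly intr p).[x] * y) = (map_poly intr p).[lambda] * s y.
  rewrite !horner_poly !mulr_suml s_sum.
  apply: eq_bigr => i _; rewrite -!mulrA -rat_int_scale sZ sX.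
  by rewrite rmorph_int.
have [i wi] : exists i, w 0 i != 0.
  apply/existsP; apply: contraNT w_neq0; rewrite negb_exists => /forallP w0.
  by apply/eqP/rowP=> i; rewrite mxE; apply/eqP; have := w0 i; rewrite negbK.
apply: (@root_monic_Aint (map_poly intr p)).
- have := sp g`_i; rewrite px0 mul0r s0 sg => /esym/eqP.
  by rewrite mulf_eq0 (negPf wi) orbF.
- exact: monic_map.
- by apply/polyOverP=> j; rewrite coef_map; apply: intr_int.
Qed.

(** The trace is rational, and it is the sum of the eigenvalues in [algC], which are algebraic
    integers. *)
Lemma mult_trace_int x : int_ring x -> exists c : int, mult_trace x = c%:~R.
Proof.
move=> Ox; suff /intrP[c cE] : (ratr (mult_trace x) : algC) \is a Num.int.
  exists c; apply: (@fmorph_inj _ _ (ratr : {rmorphism rat -> algC})).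
  by rewrite [LHS]cE rmorph_int.
apply: Cint_rat_Aint; first exact: Crat_rat.
pose A : 'M[algC]_n := map_mx ratr (mult_mx x).
have -> : ratr (mult_trace x) = \tr A by rewrite /A trace_map_mx.
have [n0|n_gt0] := posnP n.
  by rewrite /mxtrace big1 ?rpred0 // => i; have := ltn_ord i; rewrite {2}n0.
have [r rE] := closed_field_poly_normal (char_poly A).
rewrite (monicP (char_poly_monic A)) scale1r in rE.
have size_r : size r = n.
  by have := size_char_poly A; rewrite rE size_prod_XsubC => -[].
rewrite -[\tr A]opprK -char_poly_trace // rE -[in _.-1]size_r.
rewrite coefPn_prod_XsubC ?opprK; last by rewrite size_r -lt0n.
rewrite big_seq; apply: rpred_sum => z zr.
apply: (@mult_mx_eigenvalue x) => //.
by rewrite eigenvalue_root_char rE root_prod_XsubC.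
Qed.

(** Expand [x^-1] in the basis: the trace of [x x^-1 = 1] is the dimension, which is not 0. *)
Lemma mult_trace_nondegenerate x :
  (forall i : 'I_n, mult_trace (x * g`_i) = 0) -> x = 0.
Proof.
move=> Tx; apply/eqP; apply: contraT => x_neq0.
have : mult_trace (x * x^-1) = 0.
  rewrite [x^-1]basis_coord mulr_sumr linear_sum big1 // => i _.
  by rewrite -scalerAr linearZ /= Tx mulr0.
rewrite divff //= mult_trace1 => /eqP; rewrite pnatr_eq0 => /eqP n0.
have /eqP : \dim (fullv : {vspace K}) = n := size_basis g_basis.
by rewrite n0 dimv_eq0 -subv0 => /subvP/(_ 1 (memvf _)); rewrite memv0 oner_eq0.
Qed.

(** The coordinates of [x] solve a linear system whose matrix is the Gram matrix of the trace form
    and whose right-hand side, the traces of the [x g_j], is integral. By Cramer's rule the Gram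
    determinant is a common denominator. *)
Lemma bounded_denominators : (forall i : 'I_n, int_ring g`_i) ->
  exists2 N : nat, (0 < N)%N & forall x, int_ring x ->
    exists c : 'I_n -> int, N%:R * x = \sum_i (c i)%:~R * g`_i.
Proof.
move=> Og.
have /choice[T TE] : forall x, exists c : int, int_ring x -> mult_trace x = c%:~R.
  move=> x; have [/mult_trace_int[c cE]|nOx] := pselect (int_ring x).
    by exists c.
  by exists 0.
pose G : 'M[int]_n := \matrix_(i, j) T (g`_i * g`_j).
pose Gq : 'M[rat]_n := map_mx intr G.
have xG x j : \sum_i coord g i x * Gq i j = mult_trace (x * g`_j).
  rewrite [x in RHS]basis_coord mulr_suml.
  rewrite linear_sum; apply: eq_bigr => i _.
  by rewrite -scalerAl linearZ /= !mxE -TE //; apply: int_ringM.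
have Gq_unit : Gq \in unitmx.
  rewrite -row_free_unit; apply: inj_row_free => v vG.
  pose x : K := \sum_(i < n) v 0 i *: g`_i.
  have vx i : coord g i x = v 0 i by rewrite coord_sum_free ?(basis_free g_basis).
  have x0 : x = 0.
    apply: mult_trace_nondegenerate => j; rewrite -xG.
    have := congr1 (fun w : 'rV_n => w 0 j) vG; rewrite !mxE => e.
    by rewrite -[RHS]e; apply: eq_bigr => i _; rewrite vx.
  by apply/rowP=> i; rewrite -vx x0 linear0 mxE.
have detE : \det Gq = (\det G)%:~R by rewrite det_map_mx.
have d_neq0 : \det G != 0.
  by apply: contraTneq Gq_unit => d0; rewrite unitmxE detE d0 unitr0.
suff [c cP] : exists c : K -> 'I_n -> int, forall x, int_ring x ->
    (\det G)%:~R * x = \sum_i (c x i)%:~R * g`_i.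
  exists `|\det G|%N; first by rewrite absz_gt0.
  move=> x Ox; exists (fun i => (-1) ^+ (\det G < 0)%R * c x i).
  rewrite -[_%:R]/((Posz _)%:~R) abszE [in LHS]normrEsign rmorphM -mulrA cP //.
  by rewrite mulr_sumr; apply: eq_bigr => i _; rewrite mulrA rmorphM.
exists (fun x i => \sum_(j < n) T (x * g`_j) * (\adj G) j i) => x Ox.
rewrite [x in LHS]basis_coord mulr_sumr; apply: eq_bigr => i _.
rewrite -rat_int_scale scalerA -rat_int_scale; congr (_ *: _).
pose v : 'rV[rat]_n := \row_i coord g i x.
have -> : coord g i x = v 0 i by rewrite mxE.
rewrite -detE.
have -> : \det Gq * v 0 i = (v *m (Gq *m \adj Gq)) 0 i.
  by rewrite mul_mx_adj mul_mx_scalar !mxE.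
rewrite mulmxA mxE rmorph_sum; apply: eq_bigr => j _.
rewrite rmorphM /= -TE; last exact: int_ringM.
by rewrite -xG mxE -map_mx_adj !mxE; congr (_ * _); apply: eq_bigr => k _; rewrite mxE.
Qed.

End TraceForm.
End IntegralClosure.
(** * Lattices that are maximal at a prime *)

Section SaturatedBases.
Variable K : fieldExtType rat.

Lemma common_denominator n (k : 'I_n -> rat) :
  exists2 D : int, D != 0 & exists c : 'I_n -> int,
    forall i, D%:~R * k i = (c i)%:~R.
Proof.
exists (\prod_i denq (k i)); first by apply/prodf_neq0 => i _; rewrite denq_eq0.
exists (fun i => numq (k i) * \prod_(j | j != i) denq (k j)) => i.
rewrite (bigD1 i) //= !rmorphM /= mulrAC; congr (_ * _).
by rewrite mulrC -numqE.
Qed.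

Lemma intK_eq0 (c : int) : ((c%:~R : K) == 0) = (c == 0).
Proof. by rewrite -[_%:~R]mulr1 -rat_int_scale scaler_eq0 oner_eq0 orbF intr_eq0. Qed.

Lemma natK_eq0 (m : nat) : ((m%:R : K) == 0) = (m == 0)%N.
Proof. by rewrite -[m%:R]/((Posz m)%:~R) intK_eq0. Qed.

Lemma Zadjoin_multiple (alpha x : K) : generates alpha ->
  exists2 D : nat, (0 < D)%N & Zadjoin alpha (D%:R * x).
Proof.
move=> gen; have /Fadjoin1_polyP[p ->] : x \in <<1; alpha>>%VS.
  by rewrite gen memvf.
have [q [a a_neq0 ->]] := rat_poly_scale p.
exists `|a|%N; first by rewrite absz_gt0.
exists ((-1) ^+ (a < 0)%R *: q) => //.
have -> : (map_poly (in_alg K) (a%:~R^-1 *: map_poly intr q)).[alpha] =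
    (a%:~R^-1 : rat) *: (map_poly intr q).[alpha].
  rewrite map_polyZ hornerZ -map_poly_comp -[RHS]mulr_algl; congr (_ * _.[_]).
  by apply: eq_map_poly => c; rewrite /= -[RHS]mulr1 -rat_int_scale.
rewrite -[_%:R]/((Posz _)%:~R) abszE normrEsign rmorphM -mulrA.
rewrite -[a%:~R * _]rat_int_scale scalerA divff ?intr_eq0 // scale1r.
by rewrite -mul_polyC rmorphM /= map_polyC hornerM hornerC.
Qed.

(** By Gauss's lemma the minimal polynomial over [rat] is proportional to an integer factor of a
    monic integer polynomial. The leading coefficient of that factor is 1 or -1, and multiplying by
    it makes the factor monic. *)
Lemma int_minpoly (alpha : K) : int_ring alpha -> generates alpha ->
  exists2 P : {poly int}, P \is monic /\ size P = (\dim {:K}).+1 &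
    root (map_poly intr P) alpha.
Proof.
case=> P1 P1_monic rootP1 gen.
have /polyOver1P[p0 p0E] := minPolyOver 1 alpha.
have comp_intr (p : {poly int}) :
    map_poly (in_alg K) (map_poly intr p) = map_poly intr p.
  by rewrite -map_poly_comp; apply: eq_map_poly => c; rewrite /= -[RHS]mulr1 -rat_int_scale.
have : p0 %| map_poly intr P1.
  rewrite -(dvdp_map (in_alg K)) -p0E comp_intr.
  by apply: minPoly_dvdp => //; rewrite -comp_intr alg_polyOver.
case/dvdpP_rat_int=> p1 [a a_neq0 p0a] [r P1E].
have lead1 : lead_coef p1 * lead_coef r = 1 by rewrite -lead_coefM -P1E (monicP P1_monic).
have lead2 : lead_coef p1 * lead_coef p1 = 1.
  have: lead_coef p1 \is a GRing.unit by apply/unitrP; exists (lead_coef r); rewrite mulrC lead1.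
  by case/orP=> /eqP ->.
have lead_neq0 : lead_coef p1 != 0 by apply: contra_eq_neq lead2 => ->; rewrite mul0r.
have p0_size : size p0 = (\dim {:K}).+1.
  rewrite -(size_map_poly (in_alg K)) -p0E size_minPoly; congr _.+1.
  by have := dim_Fadjoin 1 alpha; rewrite dimv1 muln1 gen.
have map_intr_inj : injective (intr : int -> rat) by exact: intr_inj.
exists (lead_coef p1 *: p1); first split.
- by rewrite monicE lead_coefZ lead2.
- rewrite size_scale // -p0_size p0a size_scale //.
  by rewrite size_map_inj_poly.
rewrite map_polyZ rootZ ?intK_eq0 //.
have := root_minPoly 1 alpha; rewrite p0E p0a map_polyZ comp_intr rootZ //.
by rewrite /= scaler_eq0 negb_or a_neq0 oner_eq0.
Qed.

Variables (p : nat) (p_pr : prime p).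

(* The lattice spanned by [g] is maximal at [p]: it has index prime to [p] in
   the ring of integers. *)
Definition saturated n (g : n.-tuple K) :=
  (forall i : 'I_n, int_ring g`_i) /\
  forall (c : 'I_n -> int) z, int_ring z ->
    \sum_i (c i)%:~R * g`_i = p%:R * z -> forall i, (p %| c i)%Z.

Lemma pK_neq0 : (p%:R : K) != 0.
Proof. by rewrite natK_eq0 -lt0n prime_gt0. Qed.

Section Basis.
Variables (n : nat) (g : n.-tuple K).
Hypotheses (g_sat : saturated g) (dimK : \dim {:K} = n).

(** By descent: saturation with [z = 0] divides an integer relation by [p] as often as desired. *)
Lemma saturated_free : free g.
Proof.
apply/freeP=> k k0.
have [D D_neq0 [c cE]] := common_denominator k.
have c0 : \sum_i (c i)%:~R * g`_i = 0.
  have -> : \sum_i (c i)%:~R * g`_i = D%:~R * \sum_(i < n) k i *: g`_i.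
    rewrite mulr_sumr; apply: eq_bigr => i _.
    by rewrite -rat_int_scale -cE -scalerA rat_int_scale.
  by rewrite k0 mulr0.
suff ci0 i : c i = 0.
  move=> i; apply/eqP; have /eqP := cE i; rewrite ci0 mulf_eq0 intr_eq0.
  by rewrite (negPf D_neq0).
have dvd_c j : forall c' : 'I_n -> int, \sum_i (c' i)%:~R * g`_i = 0 ->
    ((p ^ j)%N %| c' i)%Z.
  elim: j => [|j IHj] c' c'0; first by rewrite expn0 dvd1z.
  have /choice[b bE] l : exists b : int, c' l = b * p%:Z.
    apply/dvdzP; apply: (g_sat.2 _ 0); first exact: int_ring0.
    by rewrite mulr0.
  rewrite bE expnSr PoszM dvdz_mul // IHj //.
  apply: (mulfI pK_neq0); rewrite mulr0 mulr_sumr; apply: etrans c'0.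
  by apply: eq_bigr => l _; rewrite bE rmorphM /= mulrA [_ * (b l)%:~R]mulrC.
apply/eqP; apply: contraT => ci_neq0.
have := dvd_c `|c i|%N _ c0; rewrite dvdzE /= => /dvdn_leq.
by rewrite absz_gt0 ci_neq0 leqNgt ltn_expl ?prime_gt1 // => /(_ isT).
Qed.

Lemma saturated_basis : basis_of fullv g.
Proof.
by rewrite basisEfree saturated_free subvf size_tuple dimK leqnn.
Qed.

(** Starting from a common denominator [m p^s] with [m] prime to [p], saturation removes the factors
    [p] one by one. *)
Lemma saturated_denominators : exists2 N : nat, ~~ (p %| N)%N &
  forall x, int_ring x ->
    exists c : 'I_n -> int, N%:R * x = \sum_i (c i)%:~R * g`_i.
Proof.
have [N N_gt0 NP] := bounded_denominators saturated_basis g_sat.1.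
have [m pm NE] := pfactor_coprime p_pr N_gt0.
exists m; first by rewrite -prime_coprime.
move: (logn p N) NE NP => s ->; elim: s => [|s IHs]; first by rewrite muln1.
move=> NP; apply: IHs => x Ox; have [c cE] := NP x Ox.
have /choice[b bE] l : exists b : int, c l = b * p%:Z.
  apply/dvdzP; apply: (g_sat.2 _ ((m * p ^ s)%:R * x)).
    by apply: int_ringM => //; exact: (int_ring_int _ (Posz _)).
  by rewrite -cE mulrA -natrM mulnCA expnS.
exists b; apply: (mulfI pK_neq0); rewrite mulrA -natrM mulnCA -expnS cE mulr_sumr.
by apply: eq_bigr => l _; rewrite bE rmorphM /= mulrA [_ * (b l)%:~R]mulrC.
Qed.

Section Reduction.
Variables (R : nzRingType) (N : nat).
Hypothesis NP : forall x, int_ring x ->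
  exists c : 'I_n -> int, N%:R * x = \sum_i (c i)%:~R * g`_i.

(** For integral [x] the rationals [N * coord g i x] are integers, so [numq] loses nothing. Keeping
    the factor [N] lets one definition serve both ['F_p] and ['Z_M], where [N] need not be
    invertible. *)
Definition reduction x : 'rV[R]_n :=
  \row_i (numq (N%:R * coord g i x))%:~R.

Lemma reductionE x (c : 'I_n -> int) :
  N%:R * x = \sum_i (c i)%:~R * g`_i -> reduction x = \row_i (c i)%:~R.
Proof.
move=> cE; apply/rowP=> i; rewrite !mxE; congr _%:~R.
have -> : N%:R * coord g i x = (c i)%:~R :> rat.
  have -> : N%:R * coord g i x = coord g i (((Posz N)%:~R : rat) *: x).
    by rewrite linearZ.
  rewrite rat_int_scale [X in coord g i X]cE; under eq_bigr do rewrite -rat_int_scale.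
  by rewrite coord_sum_free // saturated_free.
by rewrite numq_int.
Qed.

Lemma reductionB x y : int_ring x -> int_ring y ->
  reduction (x - y) = reduction x - reduction y.
Proof.
move=> /NP[a aE] /NP[b bE]; rewrite (reductionE aE) (reductionE bE).
rewrite (@reductionE _ (fun i => a i - b i)).
  by apply/rowP=> i; rewrite !mxE rmorphB.
rewrite mulrBr aE bE -sumrB; apply: eq_bigr => i _.
by rewrite rmorphB mulrBl.
Qed.

Lemma reduction_sum m (a : 'I_m -> int) (x : 'I_m -> K) :
    (forall j, int_ring (x j)) ->
  reduction (\sum_j (a j)%:~R * x j) = \sum_j (a j)%:~R *: reduction (x j).
Proof.
move=> Ox; have /choice[c cE] j : exists c : 'I_n -> int,
  N%:R * x j = \sum_i (c i)%:~R * g`_i by exact: NP.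
rewrite (@reductionE _ (fun i => \sum_j a j * c j i)).
  apply/rowP=> i; rewrite !mxE summxE rmorph_sum; apply: eq_bigr => j _.
  by rewrite (reductionE (cE j)) !mxE rmorphM.
rewrite mulr_sumr; under eq_bigr do rewrite mulrCA cE mulr_sumr.
rewrite exchange_big; apply: eq_bigr => i _.
by rewrite rmorph_sum mulr_suml; apply: eq_bigr => j _; rewrite rmorphM mulrA.
Qed.

End Reduction.

(** If all coordinates of [N x] are divisible by [N D'], then [x] is an integer combination of the
    [D' g_i], and [D'] is chosen to put these in [Zadjoin alpha]. *)
Lemma finite_reduction (alpha : K) : generates alpha ->
  exists (M : nat) (pi : K -> 'rV['Z_M]_n),
    (forall x y, int_ring x -> int_ring y -> pi (x - y) = pi x - pi y) /\
    (forall x, int_ring x -> pi x = 0 -> Zadjoin alpha x).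
Proof.
move=> gen; have [N N_p NP] := saturated_denominators.
have N_gt0 : (0 < N)%N by case: (N) N_p; rewrite ?dvdn0.
have /choice[D DP] (i : 'I_n) : exists D, (0 < D)%N /\ Zadjoin alpha (D%:R * g`_i).
  by have [D D_gt0 DP] := Zadjoin_multiple g`_i gen; exists D.
(* The factor [p] makes the modulus exceed 1: for [M <= 1], ['Z_M] is not the ring of integers
   modulo [M]. *)
pose D' := (p * \prod_i D i)%N.
have D'P (i : 'I_n) m : Zadjoin alpha (m%:~R * (D'%:R * g`_i)).
  rewrite /D' (bigD1 i) //= mulnCA natrM mulrAC mulrA -rat_int_scale.
  have [_ [P _ PE]] := DP i.
  exists ((m * (p * \prod_(j < n | j != i) D j)%N)%:P * P) => //.
  rewrite rmorphM /= map_polyC hornerM /= hornerC PE rmorphM /= rat_int_scale.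
  by rewrite [in RHS]mulrAC -mulrA.
have D'_gt0 : (0 < D')%N.
  by rewrite muln_gt0 prime_gt0 // prodn_gt0 // => i; case: (DP i).
have M_gt1 : (1 < N * D')%N.
  rewrite (@leq_trans D') ?leq_pmull // (@leq_trans p) ?prime_gt1 //.
  by rewrite leq_pmulr // prodn_gt0 // => i; case: (DP i).
exists (N * D')%N, (reduction 'Z_(N * D') N); split.
  by move=> x y; exact: reductionB.
move=> x Ox; have [c cE] := NP x Ox; rewrite (reductionE _ cE) => /rowP c0.
have /choice[b bE] i : exists b : int, c i = b * (N * D')%N%:Z.
  apply/dvdzP; have := c0 i; rewrite !mxE => /eqP.
  rewrite dvdzE; case: (c i) => m; rewrite ?NegzE ?rmorphN ?oppr_eq0 ?abszN /=.
    by rewrite -[_%:~R]/(_%:R) -(Zp_nat_mod M_gt1) -val_eqE /= val_Zp_nat // modn_mod.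
  by rewrite -[_%:~R]/(_%:R) -(Zp_nat_mod M_gt1) -val_eqE /= val_Zp_nat // modn_mod.
have -> : x = \sum_i (b i)%:~R * (D'%:R * g`_i).
  have N_neq0 : (N%:R : K) != 0 by rewrite natK_eq0 -lt0n.
  apply: (mulfI N_neq0); rewrite cE mulr_sumr; apply: eq_bigr => i _.
  rewrite bE rmorphM /= -[(N * D')%:~R]/((N * D')%:R) natrM; ring.
by apply: big_ind => //; [case: (zmod_Zadjoin alpha)|
  move=> y z; exact: zmod_setD (zmod_Zadjoin alpha)].
Qed.

Lemma reduction_surj N : ~~ (p %| N)%N ->
  forall v, exists2 x, int_ring x & reduction 'F_p N x = v.
Proof.
move=> N_p v; pose w i : nat := (N%:R^-1 * v 0 i : 'F_p).
exists (\sum_i (Posz (w i))%:~R * g`_i).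
  by apply: int_ring_sum => i; apply: int_ringM (g_sat.1 i); exact: int_ring_int.
rewrite (@reductionE _ _ _ (fun i => Posz N * w i)).
  apply/rowP=> i; rewrite mxE rmorphM /= -[(w i)%:~R]/((w i)%:R) natr_Zp.
  by rewrite mulVKf // -(dvdn_pcharf (pchar_Fp p_pr)).
by rewrite mulr_sumr; apply: eq_bigr => i _; rewrite rmorphM mulrA.
Qed.

(* Modulo [p] the powers of [alpha] span at most [d] dimensions. *)
Lemma prime_power_dvd_ind (alpha z : K) (q : {poly int}) (d k : nat) :
    int_ring alpha -> generates alpha -> q \is monic -> size q = d.+1 ->
    int_ring z -> (map_poly intr q).[alpha] = p%:R * z -> (d + k <= n)%N ->
  (p ^ k %| ind alpha)%N.
Proof.
move=> Oa gen q_monic size_q Oz qz dk_n.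
have [M [pi [piB kerB]]] := finite_reduction gen.
have [N N_p NP] := saturated_denominators.
pose phi := reduction 'F_p N.
pose A : 'M['F_p]_(d, n) := \matrix_(i < d) phi (alpha ^+ i).
(* The columns of [C] form a basis of the linear forms that vanish on the first [d] powers of
   [alpha] modulo [p]; there are at least [n - d >= k] of them. *)
pose C := col_base (cokermx A).
pose psi x := phi x *m C.
have psiB x y : int_ring x -> int_ring y -> psi (x - y) = psi x - psi y.
  by move=> Ox Oy; rewrite /psi /phi reductionB // mulmxBl.
have psi_surj v : exists2 x, int_ring x & psi x = v.
  have /row_fullP[B BC] : row_full C by exact: col_base_full.
  have [x Ox xE] := reduction_surj N_p (v *m B).
  by exists x => //; rewrite /psi /phi xE -mulmxA BC mulmx1.
pose H := [set x | int_ring x /\ psi x = 0].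
have zO := zmod_int_ring K.
have zH : zmod_set H.
  have psi0 : psi 0 = 0 by have := psiB _ _ zO.1 zO.1; rewrite !subrr.
  split; first by split; first exact: zO.1.
  by move=> x y [Ox x0] [Oy y0]; split; [exact: zO.2|rewrite psiB // x0 y0 subrr].
have AC : A *m C = 0.
  apply: (row_free_inj (row_base_free (cokermx A))).
  by rewrite mul0mx -mulmxA mulmx_base mulmx_coker.
have sZH : Zadjoin alpha `<=` H.
  move=> x Zx; split; first exact: Zadjoin_sub Zx.
  (* Division by [q] leaves [p] times an integral element plus a combination of the first [d]
     powers, and [psi] kills both. *)
  case: Zx => r _ <-; rewrite (Pdiv.IdomainMonic.divp_eq q_monic r).
  set h := r %/ q; set r0 := r %% q.
  have size_r0 : (size r0 <= d)%N.
    by rewrite -ltnS -size_q ltn_modp monic_neq0.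
  rewrite rmorphD rmorphM hornerD hornerM /= qz.
  have Ohz : int_ring ((map_poly intr h).[alpha] * z).
    by apply: int_ringM => //; exact: int_ring_horner.
  have -> : (map_poly intr h).[alpha] * (p%:R * z) + (map_poly intr r0).[alpha] =
      \sum_(i < d.+1) (if (i < d)%N then r0`_i else p)%:~R
      * (if (i < d)%N then alpha ^+ i else (map_poly intr h).[alpha] * z).
    rewrite big_ord_recr /= ltnn mulrCA addrC; congr (_ + _).
    rewrite (@horner_coef_wide _ d); last by rewrite (leq_trans (size_poly _ _)).
    by apply: eq_bigr => i _; rewrite ltn_ord coef_map.
  rewrite /psi /phi reduction_sum //; last first.
    by move=> i; case: ifP => _ //; exact: int_ringX.
  rewrite mulmx_suml big_ord_recr big1 /=; last first.
    move=> i _; rewrite ltn_ord -scalemxAl.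
    have := congr1 (row i) AC; rewrite row_mul rowK row0 => ->.
    by rewrite scaler0.
  by rewrite ltnn -[(Posz p)%:~R]/(p%:R) pchar_Fp_0 // scale0r mul0mx addr0.
have tow := tower zO zH (zmod_Zadjoin alpha) sZH (fun x h => h.1) piB kerB.
rewrite /ind tow dvdn_mulr // (index_kernel p_pr zO psiB psi_surj).
rewrite dvdn_exp2l // mxrank_coker.
by rewrite leq_subRL; [rewrite (leq_trans _ dk_n) // leq_add2r rank_leq_row|rewrite rank_leq_col].
Qed.

End Basis.

(** Trading [alpha^(d+j)] for [q(alpha) alpha^j = p gamma alpha^j] shows that [Zadjoin alpha]
    consists of the integer combinations of the saturated basis whose last [k] coefficients are
    divisible by [p]. Up to an index prime to [p], this is the kernel [H] of the last [k]
    coordinates modulo [p], which has index [p^k]. *)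
Lemma logn_ind (alpha gamma : K) (q : {poly int}) (d k : nat) :
    int_ring alpha -> \dim {:K} = (d + k)%N ->
    q \is monic -> size q = d.+1 -> (map_poly intr q).[alpha] = p%:R * gamma ->
    saturated [tuple if (i < d)%N then alpha ^+ i else gamma * alpha ^+ (i - d)
                | i < d + k] ->
  generates alpha /\ logn p (ind alpha) = k.
Proof.
set g := [tuple _ | _ < _] => Oa dimK q_monic size_q qg g_sat.
have gL (i : 'I_d) : g`_(lshift k i) = alpha ^+ i.
  by rewrite -tnth_nth tnth_mktuple /= ltn_ord.
have gR (j : 'I_k) : g`_(rshift d j) = gamma * alpha ^+ j.
  by rewrite -tnth_nth tnth_mktuple /= ltnNge leq_addr /= addKn.
pose E : {subfield K} := <<1; alpha>>%AS.
have alpha_in : alpha \in E by exact: memv_adjoin.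
have gamma_in : gamma \in E.
  rewrite -[gamma](mulKf pK_neq0) -qg rpredM //.
    by rewrite rpredV rpred_nat.
  rewrite horner_poly; apply: rpred_sum => i _.
  by rewrite rpredM ?rpred_int ?rpredX.
have gen : generates alpha.
  rewrite /generates -[LHS]/(E : {vspace K}); apply/eqP.
  rewrite eqEsubv subvf -(span_basis (saturated_basis g_sat dimK)).
  apply/span_subvP=> _ /tnthP[i ->]; rewrite tnth_mktuple.
  by case: ifP => _; rewrite ?rpredM ?rpredX.
split=> //.
have [P [P_monic size_P] /eqP P0] := int_minpoly Oa gen.
rewrite dimK in size_P.
have [M [pi [piB kerB]]] := finite_reduction g_sat dimK gen.
have [N N_p NP] := saturated_denominators g_sat dimK.
pose phi := reduction g 'F_p N.
pose psi x : 'rV_k := rsubmx (phi x).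
have psiB x y : int_ring x -> int_ring y -> psi (x - y) = psi x - psi y.
  move=> Ox Oy; rewrite /psi /phi (reductionB g_sat) //.
  by apply/rowP=> i; rewrite !mxE.
have psi_surj v : exists2 x, int_ring x & psi x = v.
  have [x Ox xE] := reduction_surj g_sat N_p (row_mx 0 v).
  by exists x => //; rewrite /psi /phi xE row_mxKr.
pose H := [set x | int_ring x /\ psi x = 0].
have zO := zmod_int_ring K.
have zH : zmod_set H.
  have psi0 : psi 0 = 0 by have := psiB _ _ zO.1 zO.1; rewrite !subrr.
  split; first by split; first exact: zO.1.
  by move=> x y [Ox x0] [Oy y0]; split; [exact: zO.2|rewrite psiB // x0 y0 subrr].
have zZ := zmod_Zadjoin alpha.
have ZadjoinM m x : Zadjoin alpha x -> Zadjoin alpha (m%:~R * x).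
  case=> r _ <-; exists (m%:P * r) => //.
  by rewrite rmorphM /= map_polyC hornerM hornerC.
have ZadjoinX i : Zadjoin alpha (alpha ^+ i).
  by exists 'X^i => //; rewrite map_polyXn hornerXn.
have ZadjoinP x : Zadjoin alpha x <-> exists2 c : 'I_(d + k) -> int,
    (forall j, (p %| c (rshift d j))%Z) & x = \sum_i (c i)%:~R * g`_i.
  split=> [[r _ <-]|[c cp ->]].
    rewrite (Pdiv.IdomainMonic.divp_eq P_monic r) rmorphD rmorphM hornerD hornerM.
    rewrite P0 mulr0 add0r.
    have : (size (r %% P)%R <= d + k)%N.
      by rewrite -ltnS -size_P ltn_modp monic_neq0.
    move: (r %% P)%R => {}r size_r.
    (* The remainder modulo [P] has degree below [d + k], so its quotient by [q] has at most [k]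
       coefficients, one for each [gamma alpha^j]. *)
    rewrite (Pdiv.IdomainMonic.divp_eq q_monic r).
    have size_h : (size (r %/ q)%R <= k)%N.
      by rewrite size_divp ?monic_neq0 // size_q /= leq_subLR.
    have size_r0 : (size (r %% q)%R <= d)%N.
      by rewrite -ltnS -size_q ltn_modp monic_neq0.
    move: (r %/ q)%R (r %% q)%R size_h size_r0 => h r0.
    move=> size_h size_r0.
    exists (fun i => match fintype.split i with inl i => r0`_i | inr j => h`_j * p%:Z end).
      by move=> j; rewrite (unsplitK (inr j)) dvdz_mull.
    rewrite rmorphD rmorphM hornerD hornerM /= qg big_split_ord addrC /=.
    congr (_ + _).
      rewrite (@horner_coef_wide _ d); last by rewrite (leq_trans (size_poly _ _)).
      by apply: eq_bigr => i _; rewrite (unsplitK (inl i)) gL coef_map.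
    rewrite (@horner_coef_wide _ k); last by rewrite (leq_trans (size_poly _ _)).
    rewrite mulr_suml; apply: eq_bigr => j _; rewrite (unsplitK (inr j)) gR coef_map.
    rewrite rmorphM /= -[(Posz p)%:~R]/(p%:R); ring.
  apply: big_ind; [exact: zZ.1|by move=> y z; exact: zmod_setD|move=> i _].
  case: (split_ordP i) => j ->; first by rewrite gL; apply/ZadjoinM/ZadjoinX.
  have /dvdzP[b ->] := cp j; rewrite gR rmorphM /= -[(Posz p)%:~R]/(p%:R).
  rewrite -mulrA [p%:R * _]mulrA -qg; apply: ZadjoinM.
  by exists (q * 'X^j) => //; rewrite rmorphM /= map_polyXn hornerM hornerXn.
have sZH : Zadjoin alpha `<=` H.
  move=> x Zx; split; first exact: Zadjoin_sub Zx.
  have [c cp ->] := (ZadjoinP x).1 Zx.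
  rewrite /psi /phi (@reductionE _ g g_sat _ N _ (fun i => Posz N * c i)); last first.
    by rewrite mulr_sumr; apply: eq_bigr => i _; rewrite rmorphM mulrA.
  apply/rowP=> j; rewrite !mxE; have /dvdzP[b ->] := cp j.
  by rewrite mulrA rmorphM /= -[(Posz p)%:~R]/(p%:R) pchar_Fp_0 // mulr0.
(* For [x] in [H], both [N x] and, by assumption, [p x] lie in [Zadjoin alpha]; a Bezout relation
   between [p] and [N] then gives [x]. *)
have torsion x : H x -> Zadjoin alpha (x *+ p) -> Zadjoin alpha x.
  case=> Ox x0 pxZ; have [c cE] := NP x Ox.
  have NxZ : Zadjoin alpha (N%:R * x).
    apply/ZadjoinP; exists c => // j; have := congr1 (fun v : 'rV_k => v 0 j) x0.
    rewrite /psi /phi (reductionE g_sat _ cE) !mxE.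
    case: (c _) => m; rewrite ?NegzE ?rmorphN dvdzE ?abszN /= => /eqP;
      by rewrite ?oppr_eq0 -[_%:~R]/(_%:R) -(dvdn_pcharf (pchar_Fp p_pr)).
  have /coprimeP : coprime p N by rewrite prime_coprime.
  case=> [|[u v] /= uv]; first exact: prime_gt0.
  have -> : x = (Posz u)%:~R * (x *+ p) - (Posz v)%:~R * (N%:R * x).
    rewrite -[x *+ p]mulr_natl -[(Posz u)%:~R]/(u%:R) -[(Posz v)%:~R]/(v%:R).
    rewrite !mulrA -!natrM -mulrBl -natrB ?uv ?mul1r //.
    by rewrite ltnW // -subn_gt0 uv.
  by apply: zZ.2; exact: ZadjoinM.
have sHO : H `<=` @int_ring K by move=> x [].
have tow := tower zO zH zZ sZH sHO piB kerB.
have m_p : ~~ (p %| add_index H (Zadjoin alpha))%N.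
  apply: (index_coprime (pi := pi) p_pr zH zZ sZH _ _ torsion).
    by move=> x y [Ox _] [Oy _]; exact: piB.
  by move=> x [Ox _]; exact: kerB.
rewrite /ind tow (index_kernel p_pr zO psiB psi_surj).
have m_gt0 : (0 < add_index H (Zadjoin alpha))%N.
  by rewrite lt0n; apply: contraNneq m_p => ->; rewrite dvdn0.
rewrite lognM ?expn_gt0 ?(prime_gt0 p_pr) // pfactorK //.
have /eqP -> : logn p (add_index H (Zadjoin alpha)) == 0%N.
  by rewrite -leqn0 leqNgt logn_gt0 mem_primes (negPf m_p) !andbF.
by rewrite addn0.
Qed.

End SaturatedBases.

(** * Orders: power maps, maximality and approximation modulo a prime *)

Section Orders.
Variable K : fieldExtType rat.

Definition subring_set (A : set K) :=
  [/\ zmod_set A, A 1 & forall x y, A x -> A y -> A (x * y)].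

Lemma zmod_setMz (A : set K) x (c : int) : zmod_set A -> A x -> A (c%:~R * x).
Proof.
move=> zA Ax; rewrite mulrzl; case: c => m; first exact: zmod_setMn.
by rewrite NegzE mulrNz; apply: zmod_setN (zmod_setMn _ _ _).
Qed.

Lemma subring_set_int (A : set K) (c : int) : subring_set A -> A c%:~R.
Proof. by case=> zA A1 _; rewrite -[c%:~R]mulr1; exact: zmod_setMz. Qed.

Lemma subring_setX (A : set K) x n : subring_set A -> A x -> A (x ^+ n).
Proof.
case=> _ A1 AM Ax; elim: n => [|n IHn]; first by rewrite expr0.
by rewrite exprS; apply: AM.
Qed.

Lemma int_ring_quadratic (b c x : K) :
  int_ring b -> int_ring c -> x ^+ 2 = b * x + c -> int_ring x.
Proof.
move=> Ob Oc xE; pose r : {poly K} := 'X^2 - (b *: 'X + c%:P).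
have size_r : (size (b *: 'X + c%:P)%R < size ('X^2 : {poly K})%R)%N.
  rewrite size_polyXn ltnS (leq_trans (size_polyD _ _)) // geq_max.
  rewrite (leq_trans (size_scale_leq _ _)) ?size_polyX //.
  by rewrite (leq_trans (size_polyC_leq1 _)).
apply: (@integral_root_monic _ _ _ _ r).
- by rewrite monicE lead_coefDl ?lead_coefXn // size_polyN.
- by rewrite rootE !hornerE xE subrr.
apply/integral_poly => i; rewrite coefB coefD coefZ coefC coefXn coefX.
have O_bool (d : bool) : int_ring (d%:R : K) by exact: (int_ring_int _ (Posz d)).
apply: int_ringB; first exact: O_bool.
apply: int_ringD; first by apply: int_ringM; last exact: O_bool.
by case: ifP => _ //; exact: int_ring0.
Qed.

Section Ideal.
Variables (S I : set K) (p q : nat).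
Hypotheses (SR : subring_set S) (zI : zmod_set I).
Hypothesis IM : forall x y, S x -> I y -> I (x * y).
Hypothesis Ip : forall x, S x -> I (p%:R * x).
Hypothesis frobenius :
  forall x y, S x -> S y -> I ((x + y) ^+ q - (x ^+ q + y ^+ q)).
Hypothesis q_gt1 : (1 < q)%N.

(** Modulo [I] the map [x ^+ q] is a ring endomorphism of [S], and this is its fixed subring. Hence
    [x ^+ q = x] modulo [I] has to be checked on generators only. *)
Lemma subring_fixed : subring_set [set x | S x /\ I (x ^+ q - x)].
Proof.
have [zS S1 SM] := SR.
have q_gt0 : (0 < q)%N by exact: ltnW.
split; first split.
- split; first exact: zS.1.
  by rewrite expr0n eqn0Ngt q_gt0 subr0; exact: zI.1.
- move=> x y [Sx Ix] [Sy Iy]; split; first exact: zS.2.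
  have SN := zmod_setN zS Sy.
  have IN : I ((- y) ^+ q - - y).
    (* Additivity at [y - y = 0] gives the sign rule without a case split on the parity of [q]. *)
    have -> : (- y) ^+ q - - y = - ((y ^+ q - y) + ((y - y) ^+ q - (y ^+ q + (- y) ^+ q))).
      by rewrite subrr expr0n eqn0Ngt q_gt0 /=; ring.
    by apply/(zmod_setN zI)/(zmod_setD zI) => //; exact: frobenius.
  have -> : (x - y) ^+ q - (x - y) = ((x - y) ^+ q - (x ^+ q + (- y) ^+ q)) +
      ((x ^+ q - x) + ((- y) ^+ q - - y)) by ring.
  by apply/(zmod_setD zI)/(zmod_setD zI) => //; exact: frobenius.
- by split=> //; rewrite expr1n subrr; exact: zI.1.
move=> x y [Sx Ix] [Sy Iy]; split; first exact: SM.
have -> : (x * y) ^+ q - x * y = y ^+ q * (x ^+ q - x) + x * (y ^+ q - y).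
  by rewrite exprMn; ring.
by apply: zmod_setD zI _ _; apply: IM => //; exact: subring_setX.
Qed.

Hypothesis fixed : forall x, S x -> I (x ^+ q - x).

(* An integral equation for [z], multiplied by a power of [p], puts a power
   of [y = p z] in [I], and [y] is congruent to all its [q^j]-th powers. *)
Lemma reduced_quotient y z : S y -> int_ring z -> y = p%:R * z -> I y.
Proof.
have [zS S1 SM] := SR.
move=> Sy [P P_monic /rootP Pz] yE.
set n := (size P).-1.
have size_P : size P = n.+1 by rewrite prednK // size_poly_gt0 monic_neq0.
have In : I (y ^+ n).
  have -> : y ^+ n = - \sum_(i < n) p%:R * ((P`_i)%:~R * p%:R ^+ (n - i).-1 * y ^+ i).
    apply/eqP; rewrite -addr_eq0; apply/eqP.
    transitivity (p%:R ^+ n * (map_poly intr P).[z]); last by rewrite Pz mulr0.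
    rewrite (@horner_coef_wide _ n.+1); last first.
      by rewrite -size_P size_poly.
    rewrite mulr_sumr big_ord_recr /= coef_map -/n.
    have -> : P`_n = 1 by apply/eqP; rewrite -monicE.
    rewrite /= mulr1z mul1r -exprMn -yE addrC; congr (_ + _); apply: eq_bigr => i _.
    rewrite coef_map yE exprMn /=.
    have -> : p%:R ^+ n = p%:R * (p%:R ^+ (n - i).-1 * p%:R ^+ i) :> K.
      by rewrite -exprD -exprS addnC -addnS prednK ?subn_gt0 // subnKC // ltnW.
    by ring.
  apply: zmod_setN => //; apply: big_ind; [exact: zI.1|by move=> *; exact: zmod_setD|].
  move=> i _; apply: Ip; apply: (SM); last exact: subring_setX.
  apply: (SM); first exact: subring_set_int.
  by apply: subring_setX => //; exact: (subring_set_int (Posz p)).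
have Iq j : I (y ^+ (q ^ j) - y).
  elim: j => [|j IHj]; first by rewrite expn0 expr1 subrr; exact: zI.1.
  have -> : y ^+ (q ^ j.+1) - y =
      ((y ^+ (q ^ j)) ^+ q - y ^+ (q ^ j)) + (y ^+ (q ^ j) - y).
    by rewrite -exprM expnSr; ring.
  by apply: zmod_setD => //; apply: fixed; exact: subring_setX.
have -> : y = y ^+ (q ^ n - n) * y ^+ n - (y ^+ (q ^ n) - y).
  by rewrite -exprD subnK; [ring|exact/ltnW/ltn_expl].
by apply: zI.2 => //; apply: IM => //; exact: subring_setX.
Qed.

End Ideal.

(** Carries a polynomial relation modulo [p] from a lattice element to any integral [alpha]
    congruent to it. *)
Lemma horner_congr (p : nat) (r : {poly int}) (x y z : K) :
    int_ring x -> int_ring y -> int_ring z -> x - y = p%:R * z ->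
  exists2 w, int_ring w &
    (map_poly intr r).[x] - (map_poly intr r).[y] = p%:R * w.
Proof.
move=> Ox Oy Oz xy; elim/poly_ind: r => [|r c [w Ow wE]].
  by exists 0; [exact: int_ring0|rewrite rmorph0 !horner0 subrr mulr0].
exists (w * x + (map_poly intr r).[y] * z).
  by apply: int_ringD; apply: int_ringM => //; exact: int_ring_horner.
rewrite rmorphD rmorphM /= map_polyX map_polyC /= !hornerE mulrDr mulrA -wE.
by rewrite mulrCA -xy; ring.
Qed.

(** [N] is invertible modulo [p]: from [u N = 1 + v p], [alpha] is the lattice element [u N alpha]
    minus [p v alpha]. *)
Lemma saturated_approx (p n : nat) (g : n.-tuple K) alpha :
    prime p -> saturated p g -> \dim {:K} = n -> int_ring alpha ->
  exists (c : 'I_n -> int) z, int_ring z /\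
    alpha - \sum_i (c i)%:~R * g`_i = p%:R * z.
Proof.
move=> p_pr g_sat dimK Oa.
have [N N_p NP] := saturated_denominators p_pr g_sat dimK.
have [c cE] := NP _ Oa.
have /coprimeP : coprime N p by rewrite coprime_sym prime_coprime.
case=> [|[u v] /= uv]; first by case: (N) N_p; rewrite ?dvdn0.
exists (fun i => Posz u * c i), (- v%:R * alpha); split.
  by apply: int_ringM => //; apply: int_ringN; exact: (int_ring_int _ (Posz v)).
have -> : \sum_i (Posz u * c i)%:~R * g`_i = (u * N)%:R * alpha.
  rewrite natrM -mulrA cE mulr_sumr; apply: eq_bigr => i _.
  by rewrite rmorphM mulrA.
have -> : (u * N)%N = (1 + v * p)%N by rewrite -uv subnK // ltnW // -subn_gt0 uv.
by rewrite natrD natrM; ring.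
Qed.

Lemma sum6 (c : 'I_6 -> int) (g : 6.-tuple K) :
  \sum_i (c i)%:~R * g`_i =
    (c (@Ordinal 6 0 isT))%:~R * g`_0 + (c (@Ordinal 6 1 isT))%:~R * g`_1 +
    (c (@Ordinal 6 2 isT))%:~R * g`_2 + (c (@Ordinal 6 3 isT))%:~R * g`_3 +
    (c (@Ordinal 6 4 isT))%:~R * g`_4 + (c (@Ordinal 6 5 isT))%:~R * g`_5.
Proof.
rewrite !big_ord_recr big_ord0 /= add0r.
by congr (_ + _ + _ + _ + _ + _); congr ((c _)%:~R * _); apply: val_inj.
Qed.

Lemma saturated6 (p : nat) (g : 6.-tuple K) :
    [/\ int_ring g`_0, int_ring g`_1 & int_ring g`_2] ->
    [/\ int_ring g`_3, int_ring g`_4 & int_ring g`_5] ->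
    (forall (c0 c1 c2 c3 c4 c5 : int) z, int_ring z ->
       c0%:~R * g`_0 + c1%:~R * g`_1 + c2%:~R * g`_2 +
       c3%:~R * g`_3 + c4%:~R * g`_4 + c5%:~R * g`_5 = p%:R * z ->
     [/\ (p %| c0)%Z, (p %| c1)%Z & (p %| c2)%Z] /\
     [/\ (p %| c3)%Z, (p %| c4)%Z & (p %| c5)%Z]) ->
  saturated p g.
Proof.
move=> [O0 O1 O2] [O3 O4 O5] gP; split.
  by case=> [[|[|[|[|[|[|i]]]]]]].
move=> c z Oz; rewrite sum6 => /(gP _ _ _ _ _ _ _ Oz)[[d0 d1 d2] [d3 d4 d5]] i.
by case: i => [[|[|[|[|[|[|i]]]]]] i_lt] //;
  rewrite (bool_irrelevance i_lt isT).
Qed.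

Lemma dimv_root6 (f : {poly int}) (theta : K) :
    irreducible_poly (map_poly intr f : {poly rat}) -> size f = 7%N ->
    root (map_poly intr f) theta -> generates theta ->
  \dim {:K} = 6%N /\
  forall r : {poly int}, (size r <= 6)%N -> (map_poly intr r).[theta] = 0 -> r = 0.
Proof.
move=> [_ f_irr] size_f root_f gen.
have /polyOver1P[p0 p0E] := minPolyOver 1 theta.
have comp_intr (p : {poly int}) :
    map_poly (in_alg K) (map_poly intr p) = map_poly intr p.
  rewrite -map_poly_comp; apply: eq_map_poly => c.
  by rewrite /= -[RHS]mulr1 -rat_int_scale.
have dvd_p0 r : (map_poly intr r).[theta] = 0 -> p0 %| map_poly intr r.
  move=> /rootP r0; rewrite -(dvdp_map (in_alg K)) -p0E comp_intr.
  by apply: minPoly_dvdp => //; rewrite -comp_intr alg_polyOver.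
have size_intr (r : {poly int}) : size (map_poly intr r : {poly rat}) = size r.
  by rewrite size_map_inj_poly //; exact: intr_inj.
have p0_size : size p0 = (\dim {:K}).+1.
  rewrite -(size_map_poly (in_alg K)) -p0E size_minPoly; congr _.+1.
  by have := dim_Fadjoin 1 theta; rewrite dimv1 muln1 gen.
have size7 : size p0 = 7%N.
  rewrite -size_f -size_intr; apply/eqp_size/f_irr; last exact/dvd_p0/rootP.
  by rewrite p0_size eqSS -lt0n adim_gt0.
split=> [|r size_r /dvd_p0 p0r]; first by move: p0_size; rewrite size7 => -[].
apply/eqP; rewrite -size_poly_eq0 -size_intr size_poly_eq0.
apply: contraLR p0r => r_neq0; apply/negP => /(dvdp_leq r_neq0).
by rewrite size7 size_intr leqNgt ltnS size_r.
Qed.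

End Orders.

(** * Lattices with six explicit generators *)

Section Span6.
Variable K : fieldExtType rat.

Definition span6 (x0 x1 x2 x3 x4 x5 : K) : set K :=
  [set x | exists c0 c1 c2 c3 c4 c5 : int,
    x = c0%:~R * x0 + c1%:~R * x1 + c2%:~R * x2 +
        c3%:~R * x3 + c4%:~R * x4 + c5%:~R * x5].

Lemma zmod_span6 x0 x1 x2 x3 x4 x5 : zmod_set (span6 x0 x1 x2 x3 x4 x5).
Proof.
split; first by exists 0, 0, 0, 0, 0, 0; ring.
move=> _ _ [a0 [a1 [a2 [a3 [a4 [a5 ->]]]]]] [b0 [b1 [b2 [b3 [b4 [b5 ->]]]]]].
by exists (a0 - b0), (a1 - b1), (a2 - b2), (a3 - b3), (a4 - b4), (a5 - b5); ring.
Qed.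

Lemma span6_sub (A : set K) x0 x1 x2 x3 x4 x5 : zmod_set A ->
  [/\ A x0, A x1 & A x2] -> [/\ A x3, A x4 & A x5] ->
  span6 x0 x1 x2 x3 x4 x5 `<=` A.
Proof.
move=> zA [A0 A1 A2] [A3 A4 A5] _ [c0 [c1 [c2 [c3 [c4 [c5 ->]]]]]].
by do ?apply: zmod_setD => //; exact: zmod_setMz.
Qed.

Lemma span6_sum (g : 6.-tuple K) (c : 'I_6 -> int) :
  span6 g`_0 g`_1 g`_2 g`_3 g`_4 g`_5 (\sum_i (c i)%:~R * g`_i).
Proof. by rewrite sum6; do 6!eexists. Qed.

(** Together with [span6_sub], this reduces the stability of a lattice under multiplication by [y]
    to its generators. *)
Lemma zmod_mulr (A : set K) y : zmod_set A -> zmod_set [set x | A (x * y)].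
Proof.
move=> zA; split=> [|x x' Ax Ax'] /=; first by rewrite mul0r; exact: zA.1.
by rewrite mulrBl; apply: zA.2.
Qed.

Lemma zmod_pmul (A : set K) (p : nat) :
  zmod_set A -> zmod_set [set x | exists2 s, A s & x = p%:R * s].
Proof.
move=> zA; split; first by exists 0; [exact: zA.1|rewrite mulr0].
move=> _ _ [s As ->] [t At ->].
by exists (s - t); [exact: zA.2|rewrite mulrBr].
Qed.

Lemma powers_independent (theta : K) :
    (forall r : {poly int}, (size r <= 6)%N ->
       (map_poly intr r).[theta] = 0 -> r = 0) ->
  forall c0 c1 c2 c3 c4 c5 : int,
    c0%:~R + c1%:~R * theta + c2%:~R * theta ^+ 2 + c3%:~R * theta ^+ 3 +
    c4%:~R * theta ^+ 4 + c5%:~R * theta ^+ 5 = 0 ->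
  [/\ c0 = 0, c1 = 0 & c2 = 0] /\ [/\ c3 = 0, c4 = 0 & c5 = 0].
Proof.
move=> theta_free c0 c1 c2 c3 c4 c5 c_eq0.
pose r := Poly [:: c0; c1; c2; c3; c4; c5].
have r0 : r = 0.
  apply: theta_free; first exact: size_Poly.
  rewrite (@horner_coef_wide _ 6); last by rewrite (leq_trans (size_poly _ _)) ?size_Poly.
  rewrite !big_ord_recr big_ord0 !coef_map !coef_Poly /= -[RHS]c_eq0.
  by ring.
have c i : [:: c0; c1; c2; c3; c4; c5]`_i = 0 by rewrite -coef_Poly -/r r0 coef0.
by split; split; [have := c 0|have := c 1|have := c 2|have := c 3|have := c 4|have := c 5].
Qed.

End Span6.

(** * The prime 2 *)

Section AtTwo.
Variables (K : fieldExtType rat) (theta eps v : K).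
Hypothesis dimK : \dim {:K} = 6%N.
Hypothesis theta_free : forall r : {poly int}, (size r <= 6)%N ->
  (map_poly intr r).[theta] = 0 -> r = 0.
(** The relations encode [eps = (theta^3 + 1) / 2] and [v = (theta^6 - 1) / 8]. *)
Hypotheses (thetaE : theta ^+ 3 = 2 * eps - 1) (epsE : eps ^+ 2 = eps + 2 * v).

Let S := span6 1 theta (theta ^+ 2) eps (theta * eps) (theta ^+ 2 * eps).
Hypotheses (Otheta : int_ring theta) (Oeps : int_ring eps).
(** The class of [v] modulo [2 S]. In the application [v] is an integer polynomial in [theta], and
    [theta^3 = -1] modulo 2, so three coefficients suffice. *)
Variables (v0 v1 v2 : int) (v' : K).
Hypothesis Sv' : S v'.
Hypothesis vE : v = v0%:~R + v1%:~R * theta + v2%:~R * theta ^+ 2 + 2 * v'.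

Let zS : zmod_set S := zmod_span6 _ _ _ _ _ _.

Let Sv : S v.
Proof.
rewrite vE; apply: zmod_setD => //; last exact: (zmod_setMz 2).
by exists v0, v1, v2, 0, 0, 0; ring.
Qed.

Lemma two_mul_theta x : S x -> S (x * theta).
Proof.
apply: (span6_sub (zmod_mulr theta zS)); split => /=.
- by exists 0, 1, 0, 0, 0, 0; ring.
- by exists 0, 0, 1, 0, 0, 0; ring.
- by exists (-1), 0, 0, 2, 0, 0; ring: thetaE.
- by exists 0, 0, 0, 0, 1, 0; ring.
- by exists 0, 0, 0, 0, 0, 1; ring.
have -> : theta ^+ 2 * eps * theta = eps + 4%:~R * v by ring: thetaE epsE.
by apply: zmod_setD => //; [exists 0, 0, 0, 1, 0, 0; ring|exact: zmod_setMz].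
Qed.

Lemma two_mul_theta2 x : S x -> S (x * theta ^+ 2).
Proof.
by move=> Sx; rewrite expr2 mulrA; do 2!apply: two_mul_theta.
Qed.

Lemma two_mul_eps x : S x -> S (x * eps).
Proof.
have Seps2 : S (eps * eps).
  have -> : eps * eps = eps + 2%:~R * v by ring: epsE.
  by apply: zmod_setD => //; [exists 0, 0, 0, 1, 0, 0; ring|exact: zmod_setMz].
apply: (span6_sub (zmod_mulr eps zS)); split => //=.
- by exists 0, 0, 0, 1, 0, 0; ring.
- by exists 0, 0, 0, 0, 1, 0; ring.
- by exists 0, 0, 0, 0, 0, 1; ring.
- by rewrite -mulrA mulrC; exact: two_mul_theta.
- by rewrite -mulrA mulrC; exact: two_mul_theta2.
Qed.

Lemma two_subring : subring_set S.
Proof.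
split=> //; first by exists 1, 0, 0, 0, 0, 0; ring.
move=> x y Sx Sy; move: x Sx; apply: (span6_sub (zmod_mulr y zS)); split => /=.
- by rewrite mul1r.
- by rewrite mulrC; exact: two_mul_theta.
- by rewrite mulrC; exact: two_mul_theta2.
- by rewrite mulrC; exact: two_mul_eps.
- by rewrite mulrC mulrA; apply/two_mul_eps/two_mul_theta.
- by rewrite mulrC mulrA; apply/two_mul_eps/two_mul_theta2.
Qed.

Let Stheta : S theta. Proof. by exists 0, 1, 0, 0, 0, 0; ring. Qed.
Let Seps : S eps. Proof. by exists 0, 0, 0, 1, 0, 0; ring. Qed.

Lemma two_sub_int : S `<=` @int_ring K.
Proof.
apply: span6_sub; first exact: zmod_int_ring.
  by split; [exact: int_ring1|exact: Otheta|exact: int_ringX].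
by split=> //; apply: int_ringM => //; exact: int_ringX.
Qed.

(** Doubling the relation replaces [2 eps] by [theta^3 + 1]; the independence of the powers of
    [theta] then forces each [c_i] to be [2 d_i]. *)
Lemma two_independent (c0 c1 c2 c3 c4 c5 : int) s :
    S s -> c0%:~R * 1 + c1%:~R * theta + c2%:~R * theta ^+ 2 + c3%:~R * eps +
      c4%:~R * (theta * eps) + c5%:~R * (theta ^+ 2 * eps) = 2%:R * s ->
  [/\ (2 %| c0)%Z, (2 %| c1)%Z & (2 %| c2)%Z] /\
  [/\ (2 %| c3)%Z, (2 %| c4)%Z & (2 %| c5)%Z].
Proof.
move=> [d0 [d1 [d2 [d3 [d4 [d5 ->]]]]]] cd.
have eps2 : 2 * eps = theta ^+ 3 + 1 by rewrite thetaE subrK.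
pose b c d : int := c - 2 * d.
have [] := powers_independent theta_free (c0 := 2 * b c0 d0 + b c3 d3)
  (c1 := 2 * b c1 d1 + b c4 d4) (c2 := 2 * b c2 d2 + b c5 d5)
  (c3 := b c3 d3) (c4 := b c4 d4) (c5 := b c5 d5).
  apply: etrans (_ : 2 * (c0%:~R * 1 + c1%:~R * theta + c2%:~R * theta ^+ 2 +
    c3%:~R * eps + c4%:~R * (theta * eps) + c5%:~R * (theta ^+ 2 * eps)) -
    2 * (2%:R * (d0%:~R * 1 + d1%:~R * theta + d2%:~R * theta ^+ 2 + d3%:~R * eps +
      d4%:~R * (theta * eps) + d5%:~R * (theta ^+ 2 * eps))) = 0).
    by rewrite /b; ring: thetaE.
  by rewrite cd subrr.
rewrite /b => -[b0 b1 b2] [b3 b4 b5]; clear -b0 b1 b2 b3 b4 b5.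
by split; split; lia.
Qed.

(** Modulo 2, [theta^3 = 1] and [eps] is idempotent, so both ring generators satisfy [x^4 = x]. *)
Lemma two_frobenius x : S x -> exists2 s, S s & x ^+ 4 - x = 2%:R * s.
Proof.
have SR := two_subring; have [_ S1 SM] := SR.
pose I := [set x | exists2 s, S s & x = 2%:R * s].
have zI : zmod_set I := zmod_pmul 2 zS.
have IM x' y : S x' -> I y -> I (x' * y).
  by move=> Sx [s Ss ->]; exists (x' * s); [exact: (SM)|rewrite mulrCA].
have frob x' y : S x' -> S y -> I ((x' + y) ^+ 4 - (x' ^+ 4 + y ^+ 4)).
  move=> Sx Sy; exists (2%:~R * (x' * (x' * (x' * y))) +
    3%:~R * (x' * (x' * (y * y))) + 2%:~R * (x' * (y * (y * y)))); last by ring.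
  by do ?apply: zmod_setD => //; apply: zmod_setMz => //; do 3!apply: (SM) => //.
have [zF F1 FM] := subring_fixed SR zI IM frob isT.
have Ftheta : [set x | S x /\ I (x ^+ 4 - x)] theta.
  split=> //; exists (theta * eps - theta); last by ring: thetaE.
  by apply: zS.2 => //; exact: (SM).
have Feps : [set x | S x /\ I (x ^+ 4 - x)] eps.
  split=> //; exists (v + (eps * v + eps * v) + (v * v + v * v)); last by ring: epsE.
  by do ?apply: zmod_setD => //; exact: (SM).
suff sSF : S `<=` [set x | S x /\ I (x ^+ 4 - x)] by move=> /sSF[].
have Ftheta2 : [set x | S x /\ I (x ^+ 4 - x)] (theta ^+ 2) by exact: (FM).
by apply: (span6_sub zF); split=> //; exact: (FM).
Qed.

Let g := [tuple 1; theta; theta ^+ 2; eps; theta * eps; theta ^+ 2 * eps].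

(** By [two_frobenius], [reduced_quotient] applies with [2 S] itself as the ideal, so [2 z] lies in
    [2 S]. *)
Lemma two_maximal (c0 c1 c2 c3 c4 c5 : int) z :
    int_ring z -> c0%:~R * 1 + c1%:~R * theta + c2%:~R * theta ^+ 2 +
      c3%:~R * eps + c4%:~R * (theta * eps) + c5%:~R * (theta ^+ 2 * eps) = 2%:R * z ->
  [/\ (2 %| c0)%Z, (2 %| c1)%Z & (2 %| c2)%Z] /\
  [/\ (2 %| c3)%Z, (2 %| c4)%Z & (2 %| c5)%Z].
Proof.
move=> Oz cz; have SR := two_subring; have [_ S1 SM] := SR.
pose I := [set x | exists2 s, S s & x = 2%:R * s].
have [s Ss] : I (2%:R * z); last by rewrite -cz; exact: two_independent.
apply: (reduced_quotient (S := S) (p := 2) (q := 4) SR (zmod_pmul 2 zS)) (erefl _) => //.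
- by move=> x _ Sx [s Ss ->]; exists (x * s); [exact: (SM)|rewrite mulrCA].
- by move=> x Sx; exists x.
- by move=> x /two_frobenius.
- by rewrite -cz; do 6!eexists.
Qed.

Lemma two_saturated : saturated 2 g.
Proof.
apply: saturated6 => /=; last exact: two_maximal.
  by split; [exact: int_ring1|exact: Otheta|exact: int_ringX].
by split=> //; apply: int_ringM => //; exact: int_ringX.
Qed.

Lemma two_dvd_ind (alpha : K) :
  int_ring alpha -> generates alpha -> (4 %| ind alpha)%N.
Proof.
move=> Oa gen.
have [c [z [Oz az]]] := saturated_approx (isT : prime 2) two_saturated dimK Oa.
have Sy := span6_sum g c; have [s Ss sE] := two_frobenius Sy.
pose q : {poly int} := 'X^4 - 'X.
have qE (x : K) : (map_poly intr q).[x] = x ^+ 4 - x.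
  by rewrite rmorphB /= map_polyXn map_polyX !hornerE.
have size_q : size q = 5%N by rewrite size_polyDl ?size_polyN ?size_polyX size_polyXn.
have q_monic : q \is monic.
  by rewrite monicE lead_coefDl ?lead_coefXn // size_polyN size_polyX size_polyXn.
have [w Ow] := horner_congr q Oa (two_sub_int Sy) Oz az.
rewrite [X in _ - X]qE sE => /eqP; rewrite subr_eq -mulrDr => /eqP wE.
apply: (@prime_power_dvd_ind _ 2 (isT : prime 2) 6 g two_saturated dimK _ (w + s) q 4 2) => //.
by apply: int_ringD => //; exact: two_sub_int.
Qed.

Lemma two_logn_ind : exists alpha : K,
  [/\ int_ring alpha, generates alpha & logn 2 (ind alpha) = 2%N].
Proof.
have O := two_sub_int; have zO := zmod_int_ring K; have OM := @int_ringM K.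
have OC (c : int) x : int_ring x -> int_ring (c%:~R * x) := @zmod_setMz _ _ x c zO.
have Ov : int_ring v by exact: O.
have Ov' : int_ring v' by exact: O.
(* Modulo 2, [alpha] is [theta] where [eps = 0] and [1 + theta] where [eps = 1]: its residues are 0,
   1 and, at each of the two primes with residue field [F_4], a generator [w] of that field. Since
   [gamma = v + eps theta^2] modulo 2, identifying these two fields along [alpha] makes the two
   values of [gamma] differ by [v1 + v2 + w], which is never 0. With [- theta], congruent to
   [theta ^+ 4] modulo 2, the difference would be [v1 + v2 + 1]. *)
pose alpha := eps + theta ^+ 4.
pose beta := v + eps * theta + 4%:~R * (v * (theta + theta ^+ 2)).
pose delta := beta * (eps + theta ^+ 2) + beta ^+ 2.
pose gamma := v + eps * theta ^+ 2 + 2%:~R * delta.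
have Oalpha : int_ring alpha by apply: int_ringD => //; exact: int_ringX.
have Obeta : int_ring beta.
  do ?apply: int_ringD => //; first exact: (OM).
  by apply/(OC)/(OM) => //; apply: int_ringD => //; exact: int_ringX.
have Odelta : int_ring delta.
  apply: int_ringD; last exact: int_ringX.
  by apply: (OM) => //; apply: int_ringD => //; exact: int_ringX.
have Ogamma : int_ring gamma.
  do ?apply: int_ringD => //; last exact: OC.
  by apply: (OM) => //; exact: int_ringX.
have alphaE : alpha = eps - theta + 2 * (theta * eps) by rewrite /alpha; ring: thetaE.
have alpha2 : alpha ^+ 2 = eps + theta ^+ 2 + 2 * beta.
  by rewrite alphaE /beta; ring: thetaE epsE.
have gammaE : alpha ^+ 4 - alpha = 2%:R * gamma.
  have -> : alpha ^+ 4 = (alpha ^+ 2) ^+ 2 by rewrite -exprM.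
  by rewrite alpha2 alphaE /gamma /delta; ring: thetaE epsE.
pose w3 := v + 2%:~R * (theta * v) - eps + eps * (2%:~R * eps - 1) + beta * alpha.
have alpha3 : alpha ^+ 3 = 1 + eps + theta * eps + theta ^+ 2 * eps + 2 * w3.
  by rewrite exprS alpha2 /w3 alphaE; ring: thetaE epsE.
pose w5 := theta ^+ 2 * v - theta * v - eps ^+ 2 +
  theta * eps * (v + eps * theta ^+ 2) + delta * alpha.
have gamma_alpha : gamma * alpha =
    eps * v + theta * v + theta ^+ 2 * eps + eps + 2 * w5.
  by rewrite /gamma /w5 alphaE; ring: thetaE epsE.
have Otheta2 : int_ring (theta ^+ 2) by exact: int_ringX.
have O1 := int_ring1 K.
have Ow3 : int_ring w3.
  apply: int_ringD; last exact: (OM).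
  apply: int_ringD; last by apply: (OM) => //; apply: int_ringB => //; exact: OC.
  by apply: int_ringB => //; apply: int_ringD => //; apply/(OC)/(OM).
have Ow5 : int_ring w5.
  apply: int_ringD; last exact: (OM).
  apply: int_ringD; last first.
    apply: (OM); first exact: (OM).
    by apply: int_ringD => //; exact: (OM).
  by apply: int_ringB; [apply: int_ringB; exact: (OM)|exact: int_ringX].
suff [gen ind4] : generates alpha /\ logn 2 (ind alpha) = 2%N by exists alpha.
pose q : {poly int} := 'X^4 - 'X.
have qE : (map_poly intr q).[alpha] = alpha ^+ 4 - alpha.
  by rewrite rmorphB /= map_polyXn map_polyX !hornerE.
have size_q : size q = 5%N.
  by rewrite size_polyDl ?size_polyN ?size_polyX size_polyXn.
have q_monic : q \is monic.
  by rewrite monicE lead_coefDl ?lead_coefXn // size_polyN size_polyX size_polyXn.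
apply: (@logn_ind _ 2 (isT : prime 2) alpha gamma q 4 2) => //.
  by rewrite qE.
set h := [tuple _ | _ < _]; have hE (i : 'I_6) : h`_i = _ := nth_mktuple _ _ i.
have h0 : h`_0 = 1 := hE (@Ordinal 6 0 isT).
have h1 : h`_1 = alpha := hE (@Ordinal 6 1 isT).
have h2 : h`_2 = alpha ^+ 2 := hE (@Ordinal 6 2 isT).
have h3 : h`_3 = alpha ^+ 3 := hE (@Ordinal 6 3 isT).
have h4 : h`_4 = gamma by rewrite (hE (@Ordinal 6 4 isT)) /= mulr1.
have h5 : h`_5 = gamma * alpha := hE (@Ordinal 6 5 isT).
apply: (@saturated6 K 2 h); rewrite ?h0 ?h1 ?h2 ?h3 ?h4 ?h5.
- by split=> //; exact: int_ringX.
- by split=> //; [exact: int_ringX|exact: (OM)].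
move=> c0 c1 c2 c3 c4 c5 z Oz cz.
(* [W] gathers the multiples of 2 that are dropped when the combination is reduced to the basis of
   [S], so [two_maximal] is applied to [z - W]. *)
pose W := c1%:~R * (theta * eps - theta) + c2%:~R * beta + c3%:~R * w3 +
  c4%:~R * (v' + delta) +
  c5%:~R * (w5 + eps * v' + v2%:~R * (eps - 1) + theta * v').
have OW : int_ring W.
  have Ox1 : int_ring (theta * eps - theta) by apply: int_ringB => //; exact: (OM).
  have Ox2 : int_ring (v2%:~R * (eps - 1)) by apply: (OC); exact: int_ringB.
  have Ox3 : int_ring (eps * v') by exact: (OM).
  have Ox4 : int_ring (theta * v') by exact: (OM).
  by do ?[apply: int_ringD => //]; apply: (OC) => //; do ?[apply: int_ringD => //].
have [] := @two_maximal (c0 + c3 + c4 * v0 + c5 * v2) (c1 + c4 * v1 + c5 * v0)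
  (c2 + c4 * v2 + c5 * v1) (c1 + c2 + c3 + c5 * (v0 + 1)) (c3 + c5 * v1)
  (c3 + c4 + c5 * (v2 + 1)) (z - W) (int_ringB Oz OW).
  rewrite mulrBr -cz alpha2 alpha3 gamma_alpha alphaE /gamma /W vE.
  by ring: thetaE.
(* The six congruences have coefficients in [v0], [v1], [v2]. Fixing the parities of these makes the
   system linear, and it is invertible modulo 2 in all eight cases. *)
have parity (x : int) : exists w, x = 2 * w \/ x = 2 * w + 1.
  by exists (x %/ 2)%Z; lia.
have [w0 w0E] := parity v0; have [w1 w1E] := parity v1; have [w2 w2E] := parity v2.
move=> [e0 e1 e2] [e3 e4 e5]; clear -w0E w1E w2E e0 e1 e2 e3 e4 e5.
case: w0E e0 e1 e2 e3 e4 e5 => ->; case: w1E => ->; case: w2E => -> e0 e1 e2 e3 e4 e5.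
all: by split; split; lia.
Qed.

End AtTwo.
(** * The prime 3 *)

Lemma subring_setD (K : fieldExtType rat) (A : set K) x y :
  subring_set A -> A x -> A y -> A (x + y).
Proof. by case=> zA _ _; exact: zmod_setD. Qed.

Lemma subring_setN (K : fieldExtType rat) (A : set K) x :
  subring_set A -> A x -> A (- x).
Proof. by case=> zA _ _; exact: zmod_setN. Qed.

Lemma subring_setM (K : fieldExtType rat) (A : set K) x y :
  subring_set A -> A x -> A y -> A (x * y).
Proof. by case=> _ _; apply. Qed.

Lemma subring_set_nat (K : fieldExtType rat) (A : set K) n :
  subring_set A -> A n%:R.
Proof. exact: (subring_set_int (Posz n)). Qed.

Ltac in_subring SR :=
  repeat first
    [ assumption
    | match goal with
      | |- _ 1 => case: SR => //
      | |- _ (_%:~R) => apply: (subring_set_int _ SR)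
      | |- _ (_%:R) => apply: (subring_set_nat _ SR)
      | |- _ (_ ^+ _) => apply: (subring_setX _ SR)
      | |- _ (_ + _) => apply: (subring_setD SR)
      | |- _ (- _) => apply: (subring_setN SR)
      | |- _ (_ * _) => apply: (subring_setM SR)
      end ].

(** The triangular shape makes the unknown parameters harmless: [V0] and [V1] multiply only [F4] and
    [F5], which vanish modulo 3; comparing [F5] with [c1 + c3 - c5] gives [c5 = 0], which removes
    [a], [b] and [k]; then [c2 + c4] and [c2 + 2 c4] both vanish. *)
Lemma mod3_elimination (c0 c1 c2 c3 c4 c5 a b k V0 V1 : int) :
    let F4 := k * c5 - c2 - c4 in let F5 := 2 * c5 - c1 - c3 in
    let T0 := c2 + 2 * c4 + a * c5 + V0 * F4 + V1 * F5 in
    let T1 := c3 + b * c5 + V1 * F4 + V0 * F5 in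
    (3 %| F4)%Z -> (3 %| F5)%Z -> (3 %| c0 + c2 + c4 - T0)%Z ->
    (3 %| c1 + c3 - c5 - T1)%Z -> (3 %| T0)%Z -> (3 %| T1)%Z ->
  [/\ (3 %| c0)%Z, (3 %| c1)%Z & (3 %| c2)%Z] /\
  [/\ (3 %| c3)%Z, (3 %| c4)%Z & (3 %| c5)%Z].
Proof.
move=> F4 F5; have F4E : F4 = k * c5 - c2 - c4 by [].
have F5E : F5 = 2 * c5 - c1 - c3 by [].
move: F4 F5 F4E F5E => F4 F5 F4E F5E /= /dvdzP[f4 F4f] /dvdzP[f5 F5f].
rewrite {}F4f {}F5f in F4E F5E *; move=> e0 e1 e2 e3.
have /dvdzP[d5 d5E] : (3 %| c5)%Z by lia.
rewrite d5E in F4E F5E e0 e1 e2 e3 *; clear d5E.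
have d4 : (3 %| c4)%Z by lia.
have d2 : (3 %| c2)%Z by lia.
have d3 : (3 %| c3)%Z by lia.
by split; split; lia.
Qed.

Section AtThree.
Variables (K : fieldExtType rat) (theta e u : K).
Hypothesis dimK : \dim {:K} = 6%N.
Hypothesis theta_free : forall r : {poly int}, (size r <= 6)%N ->
  (map_poly intr r).[theta] = 0 -> r = 0.
(** The relations encode [e = (theta^4 + theta^2 + 1) / 3] and [u = (theta^6 - 1) / 9]. *)
Hypotheses (thetaE : theta ^+ 4 = 3 * e - theta ^+ 2 - 1)
  (theta_e : theta ^+ 2 * e = e + 3 * u)
  (eE : e ^+ 2 = e + u * (theta ^+ 2 + 2)).

Let S := span6 1 theta (theta ^+ 2) (theta ^+ 3) e (theta * e).
Hypotheses (Otheta : int_ring theta) (Oe : int_ring e).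
Variables (u0 u1 u2 u3 : int) (u' : K).
Hypothesis Su' : S u'.
Hypothesis uE : u = u0%:~R + u1%:~R * theta + u2%:~R * theta ^+ 2 +
  u3%:~R * theta ^+ 3 + 3 * u'.

Let zS : zmod_set S := zmod_span6 _ _ _ _ _ _.

Let Su : S u.
Proof.
rewrite uE; apply: zmod_setD => //; last exact: (zmod_setMz 3).
by exists u0, u1, u2, u3, 0, 0; ring.
Qed.

Lemma three_mul_theta x : S x -> S (x * theta).
Proof.
apply: (span6_sub (zmod_mulr theta zS)); split => /=.
- by exists 0, 1, 0, 0, 0, 0; ring.
- by exists 0, 0, 1, 0, 0, 0; ring.
- by exists 0, 0, 0, 1, 0, 0; ring.
- by exists (-1), 0, (-1), 0, 3, 0; ring: thetaE.
- by exists 0, 0, 0, 0, 0, 1; ring.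
have -> : theta * e * theta = e + 3%:~R * u by ring: theta_e.
by apply: zmod_setD => //; [exists 0, 0, 0, 0, 1, 0; ring|exact: zmod_setMz].
Qed.

Lemma three_mul_thetaX x n : S x -> S (x * theta ^+ n).
Proof.
elim: n x => [|n IHn] x Sx; first by rewrite mulr1.
by rewrite exprS mulrA; apply/IHn/three_mul_theta.
Qed.

Lemma three_mul_e x : S x -> S (x * e).
Proof.
have Se : S e by exists 0, 0, 0, 0, 1, 0; ring.
have See : S (e * e).
  have -> : e * e = e + (u * theta ^+ 2 + 2%:~R * u) by ring: eE.
  apply: zmod_setD => //; apply: zmod_setD => //; last exact: zmod_setMz.
  exact: three_mul_thetaX.
apply: (span6_sub (zmod_mulr e zS)); split => //=.
- by rewrite mul1r.
- by exists 0, 0, 0, 0, 0, 1; ring.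
- by rewrite mulrC; exact: three_mul_thetaX.
- by rewrite mulrC; exact: three_mul_thetaX.
- by rewrite -mulrA mulrC; exact: three_mul_theta.
Qed.

Lemma three_subring : subring_set S.
Proof.
split=> //; first by exists 1, 0, 0, 0, 0, 0; ring.
move=> x y Sx Sy; move: x Sx; apply: (span6_sub (zmod_mulr y zS)); split => /=.
- by rewrite mul1r.
- by rewrite mulrC; exact: three_mul_theta.
- by rewrite mulrC; exact: three_mul_thetaX.
- by rewrite mulrC; exact: three_mul_thetaX.
- by rewrite mulrC; exact: three_mul_e.
- by rewrite mulrC mulrA; apply/three_mul_e/three_mul_theta.
Qed.

Let Stheta : S theta. Proof. by exists 0, 1, 0, 0, 0, 0; ring. Qed.
Let Se : S e. Proof. by exists 0, 0, 0, 0, 1, 0; ring. Qed.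

Lemma three_sub_int : S `<=` @int_ring K.
Proof.
apply: span6_sub; first exact: zmod_int_ring.
  by split; [exact: int_ring1|exact: Otheta|exact: int_ringX].
by split=> //; [exact: int_ringX|exact: int_ringM].
Qed.

Lemma three_independent (c0 c1 c2 c3 c4 c5 : int) s :
    S s -> c0%:~R * 1 + c1%:~R * theta + c2%:~R * theta ^+ 2 +
      c3%:~R * theta ^+ 3 + c4%:~R * e + c5%:~R * (theta * e) = 3%:R * s ->
  [/\ (3 %| c0)%Z, (3 %| c1)%Z & (3 %| c2)%Z] /\
  [/\ (3 %| c3)%Z, (3 %| c4)%Z & (3 %| c5)%Z].
Proof.
move=> [d0 [d1 [d2 [d3 [d4 [d5 ->]]]]]] cd.
pose b c d : int := c - 3 * d.
have [] := powers_independent theta_free (c0 := 3 * b c0 d0 + b c4 d4)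
  (c1 := 3 * b c1 d1 + b c5 d5) (c2 := 3 * b c2 d2 + b c4 d4)
  (c3 := 3 * b c3 d3 + b c5 d5) (c4 := b c4 d4) (c5 := b c5 d5).
  apply: etrans (_ : 3 * (c0%:~R * 1 + c1%:~R * theta + c2%:~R * theta ^+ 2 +
    c3%:~R * theta ^+ 3 + c4%:~R * e + c5%:~R * (theta * e)) -
    3 * (3%:R * (d0%:~R * 1 + d1%:~R * theta + d2%:~R * theta ^+ 2 +
      d3%:~R * theta ^+ 3 + d4%:~R * e + d5%:~R * (theta * e))) = 0).
    by rewrite /b; ring: thetaE.
  by rewrite cd subrr.
rewrite /b => -[b0 b1 b2] [b3 b4 b5]; clear -b0 b1 b2 b3 b4 b5.
by split; split; lia.
Qed.

(* The preimage in [S] of the nilradical of [S / 3]. *)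
Let I := [set x | exists s r, [/\ S s, S r & x = 3%:R * s + (theta ^+ 2 - 1) * r]].

Let zI : zmod_set I.
Proof.
split; first by exists 0, 0; split; [exact: zS.1|exact: zS.1|ring].
move=> _ _ [s [r [Ss Sr ->]]] [s' [r' [Ss' Sr' ->]]].
by exists (s - s'), (r - r'); split; [exact: zS.2|exact: zS.2|ring].
Qed.

Let IM x y : S x -> I y -> I (x * y).
Proof.
have SR := three_subring; move=> Sx [s [r [Ss Sr ->]]].
by exists (x * s), (x * r); split; [in_subring SR|in_subring SR|ring].
Qed.

(** Modulo [I], [theta^2 = 1] and [e] is idempotent, so cubing fixes both ring generators. *)
Lemma three_frobenius x : S x -> I (x ^+ 3 - x).
Proof.
have SR := three_subring.
have frob x' y : S x' -> S y -> I ((x' + y) ^+ 3 - (x' ^+ 3 + y ^+ 3)).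
  move=> Sx Sy; exists (x' ^+ 2 * y + x' * y ^+ 2), 0.
  by split; [in_subring SR|exact: zS.1|ring].
have [zF F1 FM] := subring_fixed SR zI IM frob isT.
pose F := [set x | S x /\ I (x ^+ 3 - x)].
have Ftheta : F theta.
  by split=> //; exists 0, theta; split; [exact: zS.1| |ring].
have Fe : F e.
  split=> //; exists (u + u * e + u ^+ 2), u; split=> //; first by in_subring SR.
  by ring: eE theta_e.
suff sSF : S `<=` F by move=> /sSF[].
by apply: (span6_sub zF); split=> //; do ?exact: (FM); exact: (subring_setX _ (And3 zF F1 FM)).
Qed.

(** With [t = theta^2 - 1], the products [t^2 = 3 (e - theta^2)] and [t e = 3 u] vanish modulo 3, so
    in [r] one may put [theta^2 = 1] and [e = 0]. *)
Lemma three_mul_t r : S r -> exists (a b : int) w, S w /\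
  (theta ^+ 2 - 1) * r = (a%:~R + b%:~R * theta) * (theta ^+ 2 - 1) + 3%:R * w.
Proof.
have SR := three_subring.
move=> [d0 [d1 [d2 [d3 [d4 [d5 ->]]]]]]; exists (d0 + d2), (d1 + d3).
exists (d2%:~R * (e - theta ^+ 2) + d3%:~R * (theta * e - theta ^+ 3) +
  d4%:~R * u + d5%:~R * (theta * u)); split; first by in_subring SR.
by ring: thetaE theta_e.
Qed.

Lemma three_nilradical z : int_ring z -> S (3%:R * z) ->
  exists (a b : int) w, S w /\
    3%:R * z = (a%:~R + b%:~R * theta) * (theta ^+ 2 - 1) + 3%:R * w.
Proof.
move=> Oz Sz; have SR := three_subring.
have [s [r [Ss Sr ->]]] : I (3%:R * z).
  apply: (reduced_quotient (S := S) (p := 3) (q := 3) SR zI) (erefl _) => //.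
  - by move=> x Sx; exists x, 0; split; [|exact: zS.1|ring].
  - exact: three_frobenius.
have [a [b [w [Sw ->]]]] := three_mul_t Sr.
by exists a, b, (s + w); split; [in_subring SR|ring].
Qed.

(* If [(s + r theta) t / 3] is integral, then so is its square, which equals
   [(s + r theta)^2 (e - theta^2) / 3] since [t^2 = 3 (e - theta^2)]. *)
Lemma three_maximal (c0 c1 c2 c3 c4 c5 : int) z :
    int_ring z -> c0%:~R * 1 + c1%:~R * theta + c2%:~R * theta ^+ 2 +
      c3%:~R * theta ^+ 3 + c4%:~R * e + c5%:~R * (theta * e) = 3%:R * z ->
  [/\ (3 %| c0)%Z, (3 %| c1)%Z & (3 %| c2)%Z] /\
  [/\ (3 %| c3)%Z, (3 %| c4)%Z & (3 %| c5)%Z].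
Proof.
move=> Oz cz; have SR := three_subring.
have [|s [r [w [Sw zE]]]] := three_nilradical Oz; first by rewrite -cz; do 6!eexists.
pose z1 := z - w.
have z1E : 3%:R * z1 = (s%:~R + r%:~R * theta) * (theta ^+ 2 - 1).
  by rewrite mulrBr zE addrK.
have Oz1 : int_ring (z1 ^+ 2) by apply/int_ringX/int_ringB => //; exact: three_sub_int.
have z1E2 : 3%:R * z1 ^+ 2 = (s%:~R + r%:~R * theta) ^+ 2 * (e - theta ^+ 2).
  apply: (@mulfI _ (3%:R : K)); first by rewrite natK_eq0.
  have -> : 3%:R * (3%:R * z1 ^+ 2) = (3%:R * z1) ^+ 2 by ring.
  by rewrite z1E; ring: thetaE theta_e.
have [|s2 [r2 [w2 [Sw2]]]] := three_nilradical Oz1.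
  by rewrite z1E2; in_subring SR.
rewrite z1E2 => z2E.
(* These are the coefficients of [3 z1^2 - (s2 + r2 theta) t], with [3 r^2 u] moved to the right.
   Those of [e] and [theta e] give [s^2 + r^2 = 0] and [s r = 0] modulo 3, which force [s] and [r]
   to vanish. *)
have [_ [_ ds dr]] : [/\ (3 %| r ^+ 2 + s2)%Z, (3 %| r2)%Z & (3 %| r ^+ 2 - s ^+ 2 - s2)%Z] /\
    [/\ (3 %| - 2 * s * r - r2)%Z, (3 %| s ^+ 2 - 2 * r ^+ 2)%Z & (3 %| 2 * s * r)%Z].
  apply: (three_independent (s := w2 - r%:~R ^+ 2 * u)); first by in_subring SR.
  rewrite mulrBr -[3%:R * w2](addKr ((s2%:~R + r2%:~R * theta) * (theta ^+ 2 - 1))).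
  by rewrite -z2E; ring: thetaE theta_e.
have residue (x : int) : exists k, x = 3 * k \/ x = 3 * k + 1 \/ x = 3 * k + 2.
  by exists (x %/ 3)%Z; lia.
have [s3 r3] : (3 %| s)%Z /\ (3 %| r)%Z.
  have [k kE] := residue s; have [l lE] := residue r; clear -ds dr kE lE.
  by case: kE ds dr => [|[]] ->; case: lE => [|[]] -> ds dr; split; lia.
have [] := three_independent (c0 := c0 + s) (c1 := c1 + r) (c2 := c2 - s)
  (c3 := c3 - r) (c4 := c4) (c5 := c5) Sw.
  rewrite -[RHS](addKr ((s%:~R + r%:~R * theta) * (theta ^+ 2 - 1))) -zE -cz.
  by ring.
move=> [e0 e1 e2] [e3 e4 e5]; clear -s3 r3 e0 e1 e2 e3 e4 e5.
by split; split; lia.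
Qed.

Let g := [tuple 1; theta; theta ^+ 2; theta ^+ 3; e; theta * e].

Lemma three_saturated : saturated 3 g.
Proof.
apply: saturated6 => /=; last exact: three_maximal.
  by split; [exact: int_ring1|exact: Otheta|exact: int_ringX].
by split=> //; [exact: int_ringX|exact: int_ringM].
Qed.

Lemma three_dvd_ind (alpha : K) :
  int_ring alpha -> generates alpha -> (3 %| ind alpha)%N.
Proof.
move=> Oa gen; have SR := three_subring.
have [c [z [Oz az]]] := saturated_approx (isT : prime 3) three_saturated dimK Oa.
have := span6_sum g c; move: az; set y := \sum_i _ => ay Sy.
have [s [r [Ss Sr yE]]] := three_frobenius Sy.
case: (Sy) => c0 [c1 [c2 [c3 [c4 [c5 /= yc]]]]].
have [A AE] : exists A, A = c0 + c2 by eexists.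
have [B BE] : exists B, B = c1 + c3 by eexists.
(* The residues of [y] at the two ramified primes, where [e = 0] and [theta] is 1 or -1, are [A + B]
   and [A - B]. The factor [X^3 - X] kills all residues; the two linear factors supply the second
   zero needed at the ramified primes. *)
pose q : {poly int} := ('X^3 - 'X) * (('X - (A + B)%:P) * ('X - (A - B)%:P)).
have qE (x : K) : (map_poly intr q).[x] =
    (x ^+ 3 - x) * ((x - A%:~R) ^+ 2 - B%:~R ^+ 2).
  rewrite !rmorphM !rmorphB /= map_polyXn map_polyX !map_polyC !hornerE /=.
  by ring.
have size_q1 : size ('X^3 - 'X : {poly int}) = 4%N.
  by rewrite size_polyDl ?size_polyN ?size_polyX size_polyXn.
have q1_monic : ('X^3 - 'X : {poly int}) \is monic.
  by rewrite monicE lead_coefDl ?lead_coefXn // size_polyN size_polyX size_polyXn.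
have q2_monic : ('X - (A + B)%:P) * ('X - (A - B)%:P) \is monic.
  by rewrite monicMl ?monicXsubC.
have size_q : size q = 6%N.
  by rewrite size_Mmonic ?monic_neq0 // size_q1 size_Mmonic ?monicXsubC ?polyXsubC_eq0 ?size_XsubC.
have q_monic : q \is monic by rewrite monicMl.
have [w Ow] := horner_congr q Oa (three_sub_int Sy) Oz ay.
pose X := c2%:~R + c3%:~R * theta; pose Y := c4%:~R + c5%:~R * theta.
pose G := (e - theta ^+ 2) * (B%:~R ^+ 2 + X * (2 * B%:~R * theta +
  (theta ^+ 2 - 1) * X + 2 * e * Y)) + u * Y * (2 * B%:~R * theta + e * Y).
(* Modulo 3, [theta^2 - 1] kills [e] and itself, so only [B^2 theta^2 - B^2] is left of the second
   factor, and it is killed too. *)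
have GE : (theta ^+ 2 - 1) * ((y - A%:~R) ^+ 2 - B%:~R ^+ 2) = 3%:R * G.
  have -> : y - A%:~R = B%:~R * theta + (theta ^+ 2 - 1) * X + e * Y.
    by rewrite yc /X /Y AE BE; ring.
  by rewrite /G; ring: thetaE theta_e.
rewrite [X in _ - X]qE yE.
have -> : (3%:R * s + (theta ^+ 2 - 1) * r) * ((y - A%:~R) ^+ 2 - B%:~R ^+ 2) =
    3%:R * (s * ((y - A%:~R) ^+ 2 - B%:~R ^+ 2) + r * G).
  by rewrite mulrDl [_ * r]mulrC -[r * _ * _]mulrA GE; ring.
move/eqP; rewrite subr_eq -mulrDr => /eqP wE.
apply: (@prime_power_dvd_ind _ 3 (isT : prime 3) 6 g three_saturated dimK
  _ _ q 5 1 _ _ _ _ _ wE) => //.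
apply: int_ringD => //; apply: three_sub_int.
have SG : S G by rewrite /G /X /Y; in_subring SR.
by in_subring SR.
Qed.

(* [E = e + u t] is an idempotent modulo 3.  The images of [theta (1 - E)] in
   the four residue fields at 3 are 0, 0, 1, -1, and its image is a uniformizer
   at the two ramified primes; the term [3 mu theta E] separates the first two
   primes modulo 9. *)
Lemma three_logn_ind : exists alpha : K,
  [/\ int_ring alpha, generates alpha & logn 3 (ind alpha) = 1%N].
Proof.
have SR := three_subring; have O := three_sub_int.
(* Introducing names through an existential makes them opaque, so that [ring] treats them as atoms
   and uses only the relations supplied. *)
have [t tE] : exists t, t = theta ^+ 2 - 1 by eexists.
have St : S t by rewrite tE; in_subring SR.
have theta2 : theta ^+ 2 = 1 + t by rewrite tE; ring.
have t2 : t ^+ 2 = 3 * (e - 1 - t) by rewrite tE; ring: thetaE.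
have te : t * e = 3 * u by rewrite tE; ring: theta_e.
have e2 : e ^+ 2 = e + u * (t + 3) by rewrite tE eE; ring.
(* [e^2 = e + u t + 3 u], so [e] need only be idempotent modulo [t] and 3; [E] is [e^2] modulo 3,
   and [e^3 = e^2] there. *)
have [E EE] : exists E, E = e + u * t by eexists.
have [V VE] : exists V, V = u + 2 * u ^+ 2 + u ^+ 2 * (e - 1 - t) by eexists.
have [D DE] : exists D, D = u * (e - t) by eexists.
have SE : S E by rewrite EE; in_subring SR.
have SV : S V by rewrite VE; in_subring SR.
have SD : S D by rewrite DE; in_subring SR.
have E2 : E ^+ 2 = E + 3 * V by rewrite EE VE; ring: t2 te e2.
have tEE : t * E = 3 * D by rewrite EE DE; ring: t2 te.
have eEE : e * E = E + 3 * (V - u * D) by rewrite EE VE DE; ring: t2 te e2.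
have [X XE] : exists X, X = u ^+ 2 * E + u ^+ 2 * (V - u * D) - u ^+ 2 * D by eexists.
have SX : S X by rewrite XE; in_subring SR.
have VEE : V * E = (u - u ^+ 2) * E + 3 * X.
  have -> : V * E = (u + 2 * u ^+ 2) * E + u ^+ 2 * (e * E - E - t * E).
    by rewrite VE; ring.
  by rewrite eEE tEE XE; ring.
(* Since [theta^2 E = E] modulo 3, [u E] reduces to [(U0 + U1 theta) E]. The value of [mu] makes the
   coefficient of [theta E] in [gamma] equal to 2 whatever [u] is, and [k] is the coefficient of
   [E]. At the two primes with [E = 1] and [theta] equal to 1 or -1, [gamma] is then [k + theta],
   with distinct values. *)
pose U0 := u0 + u2; pose U1 := u1 + u3.
pose mu := 1 + U0 - U0 ^+ 2 - U1 ^+ 2; pose k := 2 * U0 * U1 - U1.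
have [m mE] : exists m : K, m = mu%:~R by eexists.
have Sm : S m by rewrite mE; in_subring SR.
have [alpha alphaE] : exists alpha, alpha = theta * (1 - E) + 3 * (m * (theta * E)).
  by eexists.
have [Z ZE] : exists Z, Z = 3 * m ^+ 2 * (E + 3 * D) - D + (1 - 3 * m) ^+ 2 * (1 + t) * V.
  by eexists.
have SZ : S Z by rewrite ZE; in_subring SR.
have alpha2 : alpha ^+ 2 = 1 + t - E + 3 * Z.
  by rewrite alphaE ZE; ring: theta2 E2 tEE.
have [Q QE] : exists Q, Q = (e - 1 - t) - 2 * D + V + 2 * Z * (t - E) + 3 * Z ^+ 2.
  by eexists.
have SQ : S Q by rewrite QE; in_subring SR.
have Y2 : (t - E + 3 * Z) ^+ 2 = E + 3 * Q.
  have -> : (t - E + 3 * Z) ^+ 2 =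
      t ^+ 2 - 2 * (t * E) + E ^+ 2 + 6 * Z * (t - E) + 9 * Z ^+ 2 by ring.
  by rewrite t2 tEE E2 QE; ring.
have [gamma gammaE] : exists gamma, gamma =
    theta * (m * E - (1 - 3 * m) * V + Q * (1 - (1 - 3 * m) * E)) by eexists.
have alphaY2 : alpha * (alpha ^+ 2 - 1) ^+ 2 = 3 * gamma.
  have -> : alpha ^+ 2 - 1 = t - E + 3 * Z by rewrite alpha2; ring.
  by rewrite Y2 alphaE gammaE; ring: E2.
have [w1 w1E] : exists w1, w1 = - (V - u * D) + D + 2 * u * (V - u * D) - 2 * u * D - X +
  2 * Z * (V - D) + Z ^+ 2 * (1 - E) by eexists.
have Sw1 : S w1 by rewrite w1E; in_subring SR.
have [G GE] : exists G, G = -1 + u + 2 * u ^+ 2 + 2 * Z by eexists.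
have SG : S G by rewrite GE; in_subring SR.
have Q1E : m * E - V + Q * (1 - E) =
    (m + 1 - u + u ^+ 2) * E - 1 + t * G + 3 * w1.
  have -> : Q * (1 - E) = (e - e * E - 1 + E - t + t * E) -
      2 * u * (e - t - e * E + t * E) + (V - V * E) +
      2 * Z * (t - t * E - E + E ^+ 2) + 3 * Z ^+ 2 * (1 - E).
    by rewrite QE DE; ring.
  have eE' : e = E - u * t by rewrite EE; ring.
  by rewrite eEE tEE VEE E2 eE' GE w1E; ring.
have thetaE2 : theta ^+ 2 * E = E + 3 * D by rewrite theta2 mulrDl tEE; ring.
have [p1 p1E] : exists p1,
  p1 = u2%:~R * D + u3%:~R * (theta * D) + u' * E by eexists.
have Sp1 : S p1 by rewrite p1E; in_subring SR.
have uEE : u * E = (U0%:~R + U1%:~R * theta) * E + 3 * p1.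
  have -> : u * E = (u0%:~R + u1%:~R * theta) * E + u2%:~R * (theta ^+ 2 * E) +
      u3%:~R * theta * (theta ^+ 2 * E) + 3 * u' * E by rewrite [in LHS]uE; ring.
  by rewrite thetaE2 p1E /U0 /U1; ring.
have [p2 p2E] : exists p2, p2 =
  U1%:~R ^+ 2 * D + (U0%:~R + U1%:~R * theta) * p1 + u * p1 by eexists.
have Sp2 : S p2 by rewrite p2E; in_subring SR.
have u2EE : u ^+ 2 * E =
    (U0%:~R ^+ 2 + U1%:~R ^+ 2 + 2 * U0%:~R * U1%:~R * theta) * E + 3 * p2.
  have -> : u ^+ 2 * E = (U0%:~R + U1%:~R * theta) * (u * E) + 3 * u * p1.
    by rewrite expr2 -mulrA uEE mulrDr [u * (_ * E)]mulrCA uEE; ring.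
  rewrite uEE.
  have -> : (U0%:~R + U1%:~R * theta) * ((U0%:~R + U1%:~R * theta) * E + 3 * p1) =
      (U0%:~R ^+ 2 + 2 * U0%:~R * U1%:~R * theta) * E +
      U1%:~R ^+ 2 * (theta ^+ 2 * E) + 3 * (U0%:~R + U1%:~R * theta) * p1 by ring.
  by rewrite thetaE2 p2E; ring.
have [w wE] : exists w, w = k%:~R * D + theta * (p2 - p1) + theta * w1 +
  m * theta * (V + Q * E) by eexists.
have Sw : S w by rewrite wE; in_subring SR.
have gammaE' : gamma = 2 * (theta * E) + k%:~R * E - theta + theta * G * t + 3 * w.
  have -> : gamma = theta * (m * E - V + Q * (1 - E)) + 3 * m * theta * (V + Q * E).
    by rewrite gammaE; ring.
  rewrite Q1E.
  have -> : (m + 1 - u + u ^+ 2) * E = (m + 1) * E - u * E + u ^+ 2 * E by ring.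
  rewrite uEE u2EE mE.
  have -> : theta * ((mu%:~R + 1) * E - ((U0%:~R + U1%:~R * theta) * E + 3 * p1) +
     ((U0%:~R ^+ 2 + U1%:~R ^+ 2 + 2 * U0%:~R * U1%:~R * theta) * E + 3 * p2) - 1 +
     t * G + 3 * w1) = 2 * (theta * E) + k%:~R * (theta ^+ 2 * E) + 3 * (theta * (p2 - p1)) -
     theta + theta * G * t + 3 * (theta * w1) by rewrite /mu /k; ring.
  by rewrite thetaE2 wE mE; ring.
(* [g0] and [g1] stay unspecified: they enter only as factors of [c5], which vanishes modulo 3 by
   [mod3_elimination]. *)
have [g0 [g1 [wG [SwG GtE]]]] := three_mul_t (subring_setM SR Stheta SG).
rewrite -tE in GtE.
have [w3 w3E] : exists w3, w3 = theta * (V - D) + theta * (1 - E) * Z +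
  m * (theta * E) * (1 + t - E + 3 * Z) by eexists.
have Sw3 : S w3 by rewrite w3E; in_subring SR.
have alpha3 : alpha ^+ 3 = theta - theta * E + theta * t + 3 * w3.
  rewrite exprS alpha2 alphaE w3E.
  have -> : (theta * (1 - E) + 3 * (m * (theta * E))) * (1 + t - E + 3 * Z) =
      theta * (1 + t - 2 * E - t * E + E ^+ 2) + 3 * (theta * (1 - E) * Z) +
      3 * (m * (theta * E) * (1 + t - E + 3 * Z)) by ring.
  by rewrite tEE E2; ring.
have [w4 w4E] : exists w4, w4 =
  (e - 1 - t) + V - 2 * D + 2 * Z * (1 + t - E) + 3 * Z ^+ 2 by eexists.
have Sw4 : S w4 by rewrite w4E; in_subring SR.
have alpha4 : alpha ^+ 4 = 1 + 2 * t - E + 3 * w4.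
  have -> : alpha ^+ 4 = (alpha ^+ 2) ^+ 2 by rewrite -exprM.
  have -> : (alpha ^+ 2) ^+ 2 = 1 + t ^+ 2 + E ^+ 2 + 2 * t - 2 * E - 2 * (t * E) +
      6 * Z * (1 + t - E) + 9 * Z ^+ 2 by rewrite alpha2; ring.
  by rewrite t2 E2 tEE w4E; ring.
have [wE' wE'E] : exists wE',
  wE' = (u2%:~R + u3%:~R * theta) * (e - 1 - t) + u' * t by eexists.
have SwE' : S wE' by rewrite wE'E; in_subring SR.
have EE' : E = e + (U0%:~R + U1%:~R * theta) * t + 3 * wE'.
  rewrite EE wE'E [in LHS]uE.
  have -> : e + (u0%:~R + u1%:~R * theta + u2%:~R * theta ^+ 2 + u3%:~R * theta ^+ 3 +
    3 * u') * t = e + (u0%:~R + u1%:~R * theta + (u2%:~R + u3%:~R * theta) * theta ^+ 2 +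
    3 * u') * t by ring.
  have -> : e + (u0%:~R + u1%:~R * theta + (u2%:~R + u3%:~R * theta) * theta ^+ 2 +
    3 * u') * t = e + (U0%:~R + U1%:~R * theta) * t + (u2%:~R + u3%:~R * theta) * t ^+ 2 +
    3 * (u' * t) by rewrite theta2 /U0 /U1; ring.
  by rewrite t2; ring.
have [wF wFE] : exists wF, wF = U1%:~R * (e - 1 - t) + theta * wE' by eexists.
have SwF : S wF by rewrite wFE; in_subring SR.
have thetaEE : theta * E =
    theta * e + U0%:~R * (theta * t) + U1%:~R * t + 3 * wF.
  rewrite EE' wFE.
  have -> : theta * (e + (U0%:~R + U1%:~R * theta) * t + 3 * wE') =
    theta * e + U0%:~R * (theta * t) + U1%:~R * (theta ^+ 2 * t) + 3 * (theta * wE').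
    by ring.
  rewrite theta2.
  have -> : (1 + t) * t = t + t ^+ 2 by ring.
  by rewrite t2; ring.
have Salpha : S alpha by rewrite alphaE; in_subring SR.
have Sgamma : S gamma by rewrite gammaE; in_subring SR.
have Oalpha := O _ Salpha.
suff [gen ind3] : generates alpha /\ logn 3 (ind alpha) = 1%N by exists alpha.
pose q : {poly int} := 'X * (('X^2 - 1) * ('X^2 - 1)).
have q2_monic : ('X^2 - 1 : {poly int}) \is monic by exact: monicXnsubC.
have size_q2 : size ('X^2 - 1 : {poly int}) = 3%N by rewrite size_XnsubC.
have q_monic : q \is monic by rewrite !monicMl ?monicX.
have size_q : size q = 6%N.
  rewrite size_Mmonic ?polyX_eq0 // ?monicMl // size_polyX.
  by rewrite size_Mmonic ?monic_neq0 // size_q2.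
apply: (@logn_ind _ 3 (isT : prime 3) alpha gamma q 5 1) => //.
  rewrite -alphaY2 !rmorphM !rmorphB /= map_polyX map_polyXn rmorph1 !hornerE.
  by ring.
set h := [tuple _ | _ < _]; have hE (i : 'I_6) : h`_i = _ := nth_mktuple _ _ i.
have h0 : h`_0 = 1 := hE (@Ordinal 6 0 isT).
have h1 : h`_1 = alpha := hE (@Ordinal 6 1 isT).
have h2 : h`_2 = alpha ^+ 2 := hE (@Ordinal 6 2 isT).
have h3 : h`_3 = alpha ^+ 3 := hE (@Ordinal 6 3 isT).
have h4 : h`_4 = alpha ^+ 4 := hE (@Ordinal 6 4 isT).
have h5 : h`_5 = gamma by rewrite (hE (@Ordinal 6 5 isT)) /= mulr1.
apply: (@saturated6 K 3 h); rewrite ?h0 ?h1 ?h2 ?h3 ?h4 ?h5.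
- by split; apply: O; in_subring SR.
- by split; apply: O; in_subring SR.
move=> c0 c1 c2 c3 c4 c5 z Oz cz.
(* [F4] and [F5] are the coordinates on [E] and [theta E]; [T0] and [T1] are those on [t] and
   [theta t] once [E] is expanded as [e + (U0 + U1 theta) t] modulo 3. *)
pose F4 := k * c5 - c2 - c4; pose F5 := 2 * c5 - c1 - c3.
pose T0 := c2 + 2 * c4 + g0 * c5 + U0 * F4 + U1 * F5.
pose T1 := c3 + g1 * c5 + U1 * F4 + U0 * F5.
have [W WE] : exists W, W = c1%:~R * (m * (theta * E)) + c2%:~R * Z + c3%:~R * w3 +
  c4%:~R * w4 + c5%:~R * (w + wG) + F4%:~R * wE' + F5%:~R * wF by eexists.
have SW : S W by rewrite WE; in_subring SR.
have [] := @three_maximal (c0 + c2 + c4 - T0) (c1 + c3 - c5 - T1) T0 T1 F4 F5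
  (z - W) (int_ringB Oz (O _ SW)).
  have -> : (c0 + c2 + c4 - T0)%:~R * 1 + (c1 + c3 - c5 - T1)%:~R * theta +
      T0%:~R * theta ^+ 2 + T1%:~R * theta ^+ 3 + F4%:~R * e + F5%:~R * (theta * e) =
      (c0 + c2 + c4)%:~R + (c1 + c3 - c5)%:~R * theta +
      (c2 + 2 * c4 + g0 * c5)%:~R * t + (c3 + g1 * c5)%:~R * (theta * t) +
      F4%:~R * (e + (U0%:~R + U1%:~R * theta) * t) +
      F5%:~R * (theta * e + U0%:~R * (theta * t) + U1%:~R * t).
    by rewrite tE /T0 /T1; ring.
  have -> : e + (U0%:~R + U1%:~R * theta) * t = E - 3 * wE' by rewrite EE'; ring.
  have -> : theta * e + U0%:~R * (theta * t) + U1%:~R * t = theta * E - 3 * wF.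
    by rewrite thetaEE; ring.
  rewrite [in RHS]mulrBr -cz alpha2 alpha3 alpha4 gammaE'.
  have -> : theta * G * t = t * (theta * G) by rewrite mulrC.
  by rewrite GtE WE alphaE /F4 /F5; ring.
move=> [e0 e1 e2'] [e3 e4 e5].
exact: (mod3_elimination e4 e5 e0 e1 e2' e3).
Qed.

End AtThree.
(** * The field index *)

Section FieldIndex.
Variable K : fieldExtType rat.

Lemma logn_field_index (p k : nat) (theta : K) :
    prime p -> (0 < k)%N -> int_ring theta -> generates theta ->
    (forall alpha : K, int_ring alpha -> generates alpha -> (p ^ k %| ind alpha)%N) ->
    (exists alpha : K,
       [/\ int_ring alpha, generates alpha & logn p (ind alpha) = k]) ->
  logn p (field_index K) = k /\ ~ monogenic K.
Proof.
move=> p_pr k_gt0 Otheta gen_theta dvd_ind [alpha [Oalpha gen_alpha logn_alpha]].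
(* An infinite index would be recorded as 0, whose [logn] is 0; [k > 0] excludes it. *)
have ind_gt0 : (0 < ind alpha)%N.
  by case: (ind alpha) logn_alpha => // k0; rewrite -k0 logn0 in k_gt0.
have dvd_alpha : (field_index K %| ind alpha)%N.
  by apply: (set_gcdP _ _).1 (dvdnn (field_index K)) _ _; exists alpha.
split.
  apply/eqP; rewrite eqn_leq -{1}logn_alpha dvdn_leq_log //=.
  rewrite -pfactor_dvdn ?(dvdn_gt0 ind_gt0) //.
  by apply: (set_gcdP _ _).2 => _ [beta [Obeta gen_beta] <-]; exact: dvd_ind.
(* A [beta] with [int_ring = Zadjoin beta] generates [K] because [theta] is a polynomial in it; its
   index 1 contradicts the divisibility by [p ^ k]. *)
case=> beta Obeta OE; have gen_beta : generates beta.
  apply/eqP; rewrite eqEsubv subvf -{1}gen_theta.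
  have : Zadjoin beta theta by rewrite -OE.
  case=> P _ PE; apply/FadjoinP; split; first exact: sub1v.
  pose E : {subfield K} := <<1; beta>>%AS; suff : theta \in E by [].
  rewrite -PE horner_poly; apply: rpred_sum => i _.
  by rewrite rpredM ?rpred_int ?rpredX //; exact: memv_adjoin.
have := dvd_ind _ Obeta gen_beta.
rewrite /ind -OE add_index_id ?dvdn1; last exact: zmod_int_ring.
by rewrite -(expn0 p) eqn_exp2l ?prime_gt1 // -leqn0 leqNgt k_gt0.
Qed.

End FieldIndex.

(** * The sextic and the two cases of the theorem *)

Lemma size_sextic m a b c : m \in [:: 2; 3; 4; 5]%N -> size (sextic m a b c) = 7%N.
Proof.
move=> hm; rewrite /sextic -!addrA size_polyDl size_polyXn // ltnS.
have m_le5 : (m <= 5)%N by move: hm; rewrite !inE => /or4P[] /eqP ->.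
rewrite (leq_trans (size_polyD _ _)) // geq_max.
rewrite (leq_trans (size_scale_leq _ _)) ?size_polyXn //.
rewrite (leq_trans (size_polyD _ _)) // geq_max.
rewrite (leq_trans (size_scale_leq _ _)) ?size_polyX //.
by rewrite (leq_trans (size_polyC_leq1 _)).
Qed.

Lemma sextic_monic m a b c : m \in [:: 2; 3; 4; 5]%N -> sextic m a b c \is monic.
Proof.
move=> hm; rewrite monicE lead_coefE size_sextic // /sextic !coefE.
by move: hm; rewrite !inE => /or4P[] /eqP ->; rewrite /= !mulr0 !addr0.
Qed.

Theorem theorem1p1 (m : nat) (hm : m \in [:: 2; 3; 4; 5]%N) (a b c : int)
    (hirr : irreducible_poly (map_poly intr (sextic m a b c) : {poly rat}))
    (K : fieldExtType rat) (theta : K)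
    (hroot : root (map_poly intr (sextic m a b c)) theta)
    (hgen : generates theta) :
  ((8 %| a)%Z -> (8 %| b)%Z -> (8 %| c + 1)%Z ->
     logn 2 (field_index K) = 2%N /\ ~ monogenic K) /\
  ((9 %| a)%Z -> (9 %| b)%Z -> (9 %| c + 1)%Z ->
     logn 3 (field_index K) = 1%N /\ ~ monogenic K).
Proof.
have [dimK theta_free] := dimv_root6 hirr (size_sextic a b c hm) hroot hgen.
have Otheta : int_ring theta by exists (sextic m a b c) => //; exact: sextic_monic.
have thetaE : theta ^+ 6 = - (a%:~R * theta ^+ m + b%:~R * theta + c%:~R).
  move/rootP: hroot; rewrite /sextic !rmorphD /= !map_polyZ /= !map_polyXn map_polyX map_polyC.
  by rewrite !hornerE /= => /eqP; rewrite -!addrA addr_eq0 !addrA => /eqP.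
have two_neq0 : (2%:R : K) != 0 by rewrite natK_eq0.
have three_neq0 : (3%:R : K) != 0 by rewrite natK_eq0.
have Oint := @int_ring_int K; have OM := @int_ringM K; have OD := @int_ringD K.
split=> /dvdzP[a' aE] /dvdzP[b' bE] /dvdzP[c' cE]; have {}cE : c = c' * _ - 1 := canRL (addrK 1) cE.
  pose eps := (theta ^+ 3 + 1) / 2.
  pose v := - (a'%:~R * theta ^+ m + b'%:~R * theta + c'%:~R).
  have theta3 : theta ^+ 3 = 2 * eps - 1 by rewrite /eps; field; rewrite ?natK_eq0.
  have theta6 : theta ^+ 6 = 1 + 8 * v by rewrite thetaE aE bE cE /v; ring.
  have epsE : eps ^+ 2 = eps + 2 * v.
    have -> : 2 * v = (theta ^+ 6 - 1) / 4 by rewrite theta6; field; rewrite ?natK_eq0.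
    by rewrite /eps; field; rewrite ?natK_eq0.
  have Ov : int_ring v.
    apply: int_ringN; apply: (OD) => //; apply: (OD); apply: (OM) => //; exact: int_ringX.
  have Oeps : int_ring eps.
    apply: (int_ring_quadratic (b := 1) (c := 2 * v)); rewrite ?mul1r //; first exact: int_ring1.
    by apply: (OM) => //; exact: (Oint 2).
  (* For each [m], [theta^m] is reduced by [theta^3 = 2 eps - 1]; the multiples of [2 eps] go into
     [v']. *)
  have [v0 [v1 [v2 [v' [Sv' vE]]]]] : exists (v0 v1 v2 : int) (v' : K),
      span6 1 theta (theta ^+ 2) eps (theta * eps) (theta ^+ 2 * eps) v' /\
      v = v0%:~R + v1%:~R * theta + v2%:~R * theta ^+ 2 + 2 * v'.
    rewrite /v; move: hm; rewrite !inE => /or4P[] /eqP ->.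
    - exists (- c'), (- b'), (- a'), 0; split; last by ring.
      by exists 0, 0, 0, 0, 0, 0; ring.
    - exists (a' - c'), (- b'), 0, (- a'%:~R * eps); split; last by ring: theta3.
      by exists 0, 0, 0, (- a'), 0, 0; ring.
    - exists (- c'), (a' - b'), 0, (- a'%:~R * (theta * eps)); split; last by ring: theta3.
      by exists 0, 0, 0, 0, (- a'), 0; ring.
    - exists (- c'), (- b'), a', (- a'%:~R * (theta ^+ 2 * eps)); split; last by ring: theta3.
      by exists 0, 0, 0, 0, 0, (- a'); ring.
  apply: (@logn_field_index _ 2 2 theta) => //.
    by move=> alpha; exact: (two_dvd_ind dimK theta_free theta3 epsE Otheta Oeps Sv' vE).
  exact: (two_logn_ind dimK theta_free theta3 epsE Otheta Oeps Sv' vE).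
pose e := (theta ^+ 4 + theta ^+ 2 + 1) / 3.
pose u := - (a'%:~R * theta ^+ m + b'%:~R * theta + c'%:~R).
have theta4 : theta ^+ 4 = 3 * e - theta ^+ 2 - 1 by rewrite /e; field; rewrite ?natK_eq0.
have theta6 : theta ^+ 6 = 1 + 9 * u by rewrite thetaE aE bE cE /u; ring.
have uE : u = (theta ^+ 6 - 1) / 9 by rewrite theta6; field; rewrite ?natK_eq0.
have theta_e : theta ^+ 2 * e = e + 3 * u by rewrite uE /e; field; rewrite ?natK_eq0.
have eE : e ^+ 2 = e + u * (theta ^+ 2 + 2) by rewrite uE /e; field; rewrite ?natK_eq0.
have Ou : int_ring u.
  by apply: int_ringN; apply: (OD) => //; apply: (OD); apply: (OM) => //; exact: int_ringX.
have Oe : int_ring e.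
  apply: (int_ring_quadratic (b := 1) (c := u * (theta ^+ 2 + 2))); rewrite ?mul1r //.
    exact: int_ring1.
  by apply: (OM) => //; apply: (OD); [exact: int_ringX|exact: (Oint 2)].
have [u0 [u1 [u2 [u3 [u' [Su' uE']]]]]] : exists (u0 u1 u2 u3 : int) (u' : K),
    span6 1 theta (theta ^+ 2) (theta ^+ 3) e (theta * e) u' /\
    u = u0%:~R + u1%:~R * theta + u2%:~R * theta ^+ 2 + u3%:~R * theta ^+ 3 + 3 * u'.
  rewrite /u; move: hm; rewrite !inE => /or4P[] /eqP ->.
  - exists (- c'), (- b'), (- a'), 0, 0; split; last by ring.
    by exists 0, 0, 0, 0, 0, 0; ring.
  - exists (- c'), (- b'), 0, (- a'), 0; split; last by ring.
    by exists 0, 0, 0, 0, 0, 0; ring.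
  - exists (a' - c'), (- b'), a', 0, (- a'%:~R * e); split; last by ring: theta4.
    by exists 0, 0, 0, 0, (- a'), 0; ring.
  - exists (- c'), (a' - b'), 0, a', (- a'%:~R * (theta * e)); split; last by ring: theta4.
    by exists 0, 0, 0, 0, 0, (- a'); ring.
apply: (@logn_field_index _ 3 1 theta) => //.
  by move=> alpha; exact: (three_dvd_ind dimK theta_free theta4 theta_e eE Otheta Oe Su' uE').
exact: (three_logn_ind dimK theta_free theta4 theta_e eE Otheta Oe Su' uE').
Qed.
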